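(* Assume the max-arm structure with scalar identifying scores $h_a:\widetilde{\mathcal W}\to\mathbb R$, and suppose the standing model conditions and the max-arm perturbation conditions hold. Fix $P\in\mathcal P$, a measurable $w:\mathcal X\to\mathcal W_{\mathrm{aux}}$, and $f\in\mathcal F_{\mathrm B}$. Assume that for $P_X$-a.e. $x$: $g(x,a,\cdot)$ is continuously differentiable with $g_a'(x):=\partial_{u_a}g(x,a,u_{P,a}(x))\ne0$; every active link $g(x,a,\cdot)$, $a\in\mathcal A^*(x;P)$, is affine on $\{u_{P,a}(x)+r_{x,a}(t):|t|<\epsilon_P(x)\}$, where $r_x$ is the tie-preserving path of the perturbation conditions; $\pi_a^P(x)>0$ and $\sigma_a^2(x;P)<\infty$ for all $a\in\mathcal A$; and $\sigma_a^2(x;P)>0$ for $a\in\mathcal A^*(x;P)$. Then there exist measurable $\beta_a,c_a:\mathcal X\to\mathbb R$ ($a\in\mathcal A$) and a Borel set $N_{f,P,w}$ with $P_X(N_{f,P,w})=0$ such that for every $x\notin N_{f,P,w}$ and every $a\in\mathcal A$, $$f_w^P(x,(a,\widetilde w))=\beta_a(x)h_a(\widetilde w)+c_a(x)\qquad Q_{x,a}^P\text{-a.s.},$$ with the following constraints. (1) If $\mathcal A^*(x;P)=\{a^*\}$, then $\beta_{a^*}(x)=g_{a^*}'(x)/\pi_{a^*}^P(x)$ and $\beta_a(x)=0$ for $a\in\mathcal R_P(x)$. (2) If $|\mathcal A^*(x;P)|\ge2$, then $\beta_a(x)=0$ for every $a\in\mathcal R_P(x)$, and $\sum_{a\in\mathcal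 A^*(x;P)}\pi_a^P(x)\,\beta_a(x)/g_a'(x)=1$. The intercepts satisfy $\sum_{a\in\mathcal A}\pi_a^P(x)\{\beta_a(x)u_{P,a}(x)+c_a(x)\}=\bar\psi(x,\eta(P)(x),\kappa(P)(x))$.
   Context: General framework. $\mathcal X,\mathcal W$ are Polish spaces and $\mathcal P$ is a fixed class of Borel probability measures on $\mathcal X\times\mathcal W$. For $P\in\mathcal P$, $P_X$ is the marginal on $\mathcal X$ and $Q_x^P$ the regular conditional law of $W$ given $X=x$. The target is $\Psi(P)=E_{P_X}[\psi(X,u_P(X))]$ with $\psi$, $u_P$ measurable, $\psi(\cdot,u_P(\cdot))\in L^1(P_X)$, and $u_P(x)=u_{\mathrm{loc}}(x,Q_x^P)$ for one rule $u_{\mathrm{loc}}$. A nuisance declaration consists of measurable maps $\eta_j(P):\mathcal X\to\mathcal N_{0,j}$ ($j\le d$; $\mathcal N_0=\prod_j\mathcal N_{0,j}$), $\kappa(P):\mathcal X\to\mathcal K_0$ with $\kappa(P)(x)=\kappa_\flat(x,\eta(P)(x))$ for a measurable $\kappa_\flat$, and a Polish space $\mathcal W_{\mathrm{aux}}$, together with a measurable $\bar\psi$ such that $\psi(x,u_P(x))=\bar\psi(x,\eta(P)(x),\kappa(P)(x))$ $P_X$-a.s. The class $\mathcal F_{\mathrm B}$ consists of all measurable $f:\mathcal X\times\mathcal W\times\mathcal N_0\times\mathcal K_0\times\mathcal W_{\mathrm{aux}}\to\mathbb R$ such that for all $P,P'\in\mathcal P$ and measurable $w:\mathcal X\to\mathcal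 W_{\mathrm{aux}}$: if for some $j$, $\eta_l(P')=\eta_l(P)$ $P_X$-a.s. for all $l\ne j$, then $f(X,W,\eta(P')(X),\kappa(P)(X),w(X))\in L^1(P)$ with $P$-expectation $\Psi(P)$. Write $f_w^P(x,W)=f(x,W,\eta(P)(x),\kappa(P)(x),w(x))$. Standing model conditions. Fix a Borel graph $\{(x,Q):Q\in\mathfrak K_x\}$ of admissible conditional laws with Borel maps $\eta_{\mathrm{loc}}(x,Q),\kappa_{\mathrm{loc}}(x,Q)$ on it. (a) For $P\in\mathcal P$ and $P_X(A)>0$, the law with marginal $P_X(\cdot\cap A)/P_X(A)$ and the kernel of $P$ is in $\mathcal P$, with the same $\eta,\kappa$ values as $P$ on $A$. (b) There is a finite Borel cost $C(x,Q)\ge1$ on the graph with $|\psi(x,u_{\mathrm{loc}}(x,Q))|\le C(x,Q)$ (the integrand being Borel), also controlling the moments required by the model; each $P\in\mathcal P$ has $Q_x^P\in\mathfrak K_x$ a.s. and $\int C(x,Q_x^P)dP_X<\infty$; each universally measurable selection $R_x\in\mathfrak K_x$ with $\int C(x,R_x)dP_X<\infty$ defines, with marginal $P_X$, a law in $\mathcal P$. (c) $\eta(P)(x)=\eta_{\mathrm{loc}}(x,Q_x^P)$ and $\kappa(P)(x)=\kappa_{\mathrm{loc}}(x,Q_x^P)$ for $P_X$-a.e. $x$, and likewise for the integrand. Selections of non-integrable cost are localized: they are used on $\{C\le m\}$ and replaced by the baseline kernel elsewhere. Max-arm structure. $\mathcal A$ is a finite set, $\mathcal W=\mathcal A\times\widetilde{\mathcal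 W}$, $W=(A,\widetilde W)$, $Q_x^P(da,d\widetilde w)=\pi_a^P(x)Q_{x,a}^P(d\widetilde w)$ with all $\pi_a^P(x)>0$; $u_P(x)=(u_{P,a}(x))_{a\in\mathcal A}$ with $u_{P,a}(x)\in\mathcal U_0\subseteq\mathbb R$; $\psi(x,u)=\max_{a}g(x,a,u_a)$ with $g$ measurable and smooth in $u_a$. Declaration: $d=2$, $\eta_1(P)=(u_{P,a})_a$, $\eta_2(P)=\pi^P$ (in the open simplex), $\kappa(P)(x)=\mathcal A^*(x;P)=\arg\max_a g(x,a,u_{P,a}(x))$ (the active set), $\mathcal K_0$ the nonempty subsets of $\mathcal A$. Identifying scores are measurable $h_a$ with $u_{P,a}(x)=E_{Q_{x,a}^P}[h_a(\widetilde W)]$ for all $P,x,a$; $\sigma_a^2(x;P)=\mathrm{Var}_{Q_{x,a}^P}[h_a]$. Max-arm perturbation conditions. For every $P\in\mathcal P$ and $P_X$-a.e. $x$: (X1) For every $a$, holding $\pi^P(x)$ and the other arm laws fixed, for every $\epsilon\in(0,1)$ and every finitely supported probability $\nu$ on $\mathrm{supp}\,Q_{x,a}^P$ with $E_\nu[h_a]=u_{P,a}(x)$, the admissible arm-$a$ laws contain $(1-\epsilon)Q_{x,a}^P+\epsilon\nu$. The resulting correspondence has Borel graph and finite cost $C$; selections with integrable cost glue to a law in $\mathcal P$ with the same $P_X,\eta,\kappa$ (others are cost-localized). (X2) There are a Borel-graph correspondence $x\mapsto D_x\subseteq\mathbb R^{|\mathcal A|}$ with $0\in D_x$ and a measurable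 correspondence $\mathcal R_P(x)\subseteq\mathcal A\setminus\mathcal A^*(x;P)$ such that for $a\in\mathcal R_P(x)$, $t e_a\in D_x$ for all sufficiently small $t$ that leave $a$ inactive. Moreover $D_x$ contains a jointly measurable path $r_x(t)$, $|t|<\epsilon_P(x)$, with $\epsilon_P:\mathcal X\to(0,\infty)$ measurable, whose inactive coordinates are zero and which satisfies $g(x,a,u_{P,a}(x)+r_{x,a}(t))=g(x,a,u_{P,a}(x))+t$ for $a\in\mathcal A^*(x;P)$ (the tie-preserving path). (X3) For every $\delta\in D_x$ there is a law $Q_{x,\delta}\ll Q_x^P$ on $\mathcal A\times\widetilde{\mathcal W}$ with arm probabilities $\pi^P(x)$ and arm score means $u_P(x)+\delta$, with $Q_{x,0}=Q_x^P$. The perturbation changes only $\eta_1$ and preserves $\eta_2$ and $\kappa$. The correspondence of these laws has Borel graph and finite cost $C$; every universally measurable selection $x\mapsto Q_{x,\delta(x)}$ with integrable cost glues to a law in $\mathcal P$ with marginal $P_X$ (direction $0$ is used outside each cost-localized set).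
   Formalization: The tie-preserving path is additionally assumed to start at the null direction, r_x(0)=0; without this, when several arms are active and links are not injective, affineness along the path says nothing about g_a' at u_P(x) and the sum constraint in (2) can fail. *)

(* Defs.v *)
From HB Require Import structures.
From mathcomp Require Import all_boot all_order all_algebra.
From mathcomp Require Import all_classical all_reals all_analysis.
From mathcomp Require Import giry.

Set Implicit Arguments.
Unset Strict Implicit.
Unset Printing Implicit Defensive.
Import Order.TTheory GRing.Theory Num.Theory.
Import numFieldNormedType.Exports.

Local Open Scope classical_set_scope.
Local Open Scope ring_scope.

#[short(type="pfinType")]
HB.structure Definition PointedFinite := {T of Finite T & Pointed T}.

HB.instance Definition _ (T : finType) := isPointed.Build {set T} finset.set0.

Definition borel (T : ptopologicalType) : measurableType (@open T).-sigma :=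
  g_sigma_algebraType (@open T).

Definition discrete (T : pointedType) : measurableType (@setT (set T)).-sigma :=
  g_sigma_algebraType (@setT (set T)).

Definition cylinders (R : realType) (A : Type) : set (set (A -> R)) :=
  [set E | exists a (B : set R),
     measurable B /\ E = (fun v : A -> R => v a) @^-1` B].

(** [R^A] with its product sigma-algebra. *)
Definition vec (R : realType) (A : Type)
    : measurableType (@cylinders R A).-sigma :=
  g_sigma_algebraType (@cylinders R A).

Definition polish (R : realType) (T : topologicalType) : Prop :=
  (exists2 S : set T, countable S & dense S) /\
  exists dist : T -> T -> R,
    [/\ forall x y, dist x y = 0 <-> x = y,
        forall x y, dist x y = dist y x,
        forall x y z, dist x z <= dist x y + dist y z,
        forall x (U : set T), nbhs x U <->
          exists2 e : R, 0 < e & [set y | dist x y < e] `<=` U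
      & forall s : nat -> T,
          (forall e : R, 0 < e -> exists N : nat, forall m n : nat,
             (N <= m)%N -> (N <= n)%N -> dist (s m) (s n) < e) ->
          exists l : T, s @ \oo --> l].

(** Measurability on the subspace [D] with its trace sigma-algebra.  For
    non-measurable [D], [measurable_fun D f] would hold vacuously. *)
Definition trace_measurable_fun d d' (T : measurableType d)
    (U : measurableType d') (D : set T) (f : T -> U) : Prop :=
  forall B, measurable B ->
    exists2 E, measurable E & D `&` f @^-1` B = D `&` E.

Definition univ_measurable (R : realType) d (T : measurableType d)
    (E : set T) : Prop :=
  forall mu : probability T R, exists E1 E2 : set T,
    [/\ measurable E1, measurable E2, E1 `<=` E, E `<=` E2
      & mu (E2 `\` E1) = 0%E].

Definition univ_measurable_fun (R : realType) d d' (T : measurableType d)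
    (U : measurableType d') (f : T -> U) : Prop :=
  forall B, measurable B -> univ_measurable R (f @^-1` B).

Definition supp (R : realType) (T : ptopologicalType)
    (mu : probability (borel T) R) : set T :=
  [set t | forall U : set T, open U -> U t -> (0 < mu U)%E].

Definition finitely_supported_on (R : realType) (T : ptopologicalType)
    (nu : probability (borel T) R) (S : set T) : Prop :=
  exists F : set T, [/\ finite_set F, F `<=` S & nu F = 1%E].

Definition cont_diff_on (R : realType) (S : set R) (phi : R -> R) : Prop :=
  (forall v, S v -> derivable phi v 1) /\ {within S, continuous (derive1 phi)}.

Definition affine_on (R : realType) (S : set R) (phi : R -> R) : Prop :=
  exists s b : R, forall v, S v -> phi v = s * v + b.

HB.instance Definition _ d1 d2 (T1 : measurableType d1)
    (T2 : measurableType d2) :=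
  isMeasurableFun.Build _ _ (T1 * T2)%type T1 fst measurable_fst.

Section laws.
Context (R : realType) (A : pfinType) (X Wt : ptopologicalType).

Definition obs := (discrete A * borel Wt)%type.
Definition law := probability (borel X * obs)%type R.

Definition marginal (P : law) : probability (borel X) R := distribution P fst.

(** [Q] is a regular conditional law of the second coordinate given the
    first. *)
Definition regular_cond_law (P : law) (Q : X -> probability obs R) : Prop :=
  measurable_fun [set: borel X] (Q : borel X -> pprobability obs R) /\
  forall (E : set (borel X)) (B : set obs), measurable E -> measurable B ->
    P (E `*` B) = (\int[marginal P]_(x in E) Q x B)%E.

(** [Q(da, dw) = p_a L_a(dw)]. *)
Definition arm_decomposition (Q : probability obs R) (p : A -> R)
    (L : A -> probability (borel Wt) R) : Prop :=
  forall (a : A) (B : set (borel Wt)), measurable B ->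
    Q ([set a] `*` B) = ((p a)%:E * L a B)%E.

Definition max_arm (g : X -> A -> R -> R) (x : X) (u : A -> R) : R :=
  \big[Num.max/g x point (u point)]_(a : A) g x a (u a).

Definition active (g : X -> A -> R -> R) (x : X) (u : A -> R) : {set A} :=
  [set a | [forall b, g x b (u b) <= g x a (u a)]]%SET.

Definition simplex : set (A -> R) :=
  [set p | (forall a, 0 < p a) /\ \sum_a p a = 1].

End laws.

(** [uval P] and [propensity P] are the two nuisances [eta_1(P)] and
    [eta_2(P)].  Link functions [link] are total on the line, so that two-sided
    derivatives make sense; their measurability and smoothness are only
    required on [arm_range], the set of admissible arm values.  The
    maps [eta1_loc], [eta2_loc], [kappa_loc] and [cost] are only meaningful on
    the graph of [adm]. *)
Record max_arm_model (R : realType) (A : pfinType) (X Wt : ptopologicalType) :=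
  MaxArmModel {
  laws : set (law R A X Wt) ;
  cond : law R A X Wt -> X -> probability (obs A Wt) R ;
  propensity : law R A X Wt -> X -> A -> R ;
  arm_law : law R A X Wt -> A -> X -> probability (borel Wt) R ;
  arm_range : set R ;
  uval : law R A X Wt -> X -> A -> R ;
  uval_loc : X -> probability (obs A Wt) R -> A -> R ;
  link : X -> A -> R -> R ;
  score : A -> Wt -> R ;
  psibar : X * ((A -> R) * (A -> R)) * {set A} -> R ;
  adm : X -> set (probability (obs A Wt) R) ;
  eta1_loc : X -> probability (obs A Wt) R -> A -> R ;
  eta2_loc : X -> probability (obs A Wt) R -> A -> R ;
  kappa_loc : X -> probability (obs A Wt) R -> {set A} ;
  cost : X -> probability (obs A Wt) R -> R
}.

(** Perturbation data, for each law [P] of the model: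
    - [arm_adm P a x]: the admissible arm-[a] laws at [x];
    - [dirs P x], [relaxed P x], [tie_path P x t], [path_radius P x]: the
      set [D_x] of directions, the set [R_P(x)] of inactive arms, the
      tie-preserving path [r_x(t)] and its radius [eps_P(x)];
    - [shifted P x delta]: the law [Q_{x,delta}]. *)
Record perturbation_data (R : realType) (A : pfinType)
    (X Wt : ptopologicalType) := PerturbationData {
  arm_adm : law R A X Wt -> A -> X -> set (probability (borel Wt) R) ;
  dirs : law R A X Wt -> X -> set (A -> R) ;
  relaxed : law R A X Wt -> X -> {set A} ;
  tie_path : law R A X Wt -> X -> R -> A -> R ;
  path_radius : law R A X Wt -> X -> R ;
  shifted : law R A X Wt -> X -> (A -> R) -> probability (obs A Wt) R
}.

Section model.
Context (R : realType) (A : pfinType) (X Wt : ptopologicalType).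
Variables (M : max_arm_model R A X Wt) (D : perturbation_data R A X Wt).

Local Notation law := (law R A X Wt).
Local Notation obs := (obs A Wt).
Local Notation P_X P := (marginal P).
Local Notation armset := (discrete {set A}).

Definition psi (x : X) (v : A -> R) : R := max_arm (link M) x v.

(** The discrete nuisance is [kappa_flat(x, eta(P)(x))] with
    [kappa_flat(x, (v, p)) := active (link M) x v]. *)
Definition kappa (P : law) (x : X) : {set A} := active (link M) x (uval M P x).

Definition N1 : set (A -> R) := [set v | forall a, arm_range M (v a)].
Definition N2 : set (A -> R) := @simplex R A.
Definition K0 : set {set A} := [set S | S != finset.set0].

Definition target (P : law) : \bar R :=
  (\int[P_X P]_x (psi x (uval M P x))%:E)%E.

Definition link_deriv (P : law) (a : A) (x : X) : R :=
  derive1 (link M x a) (uval M P x a).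

Definition max_arm_structure : Prop :=
  [/\ [/\ forall a, trace_measurable_fun
            [set z : borel X * R | arm_range M z.2] (fun z => link M z.1 a z.2),
          forall x a, cont_diff_on (arm_range M) (link M x a)
        & forall a, measurable_fun [set: borel Wt] (score M a)],
      forall P, laws M P ->
        [/\ regular_cond_law P (cond M P),
            measurable_fun [set: borel X]
              (propensity M P : borel X -> vec R A),
            forall a, measurable_fun [set: borel X]
              (arm_law M P a : borel X -> pprobability (borel Wt) R),
            forall x, arm_decomposition (cond M P x) (propensity M P x)
              (fun a => arm_law M P a x)
          & forall x a, 0 < propensity M P x a],
      forall P, laws M P ->
        [/\ measurable_fun [set: borel X] (uval M P : borel X -> vec R A),
            forall x a, arm_range M (uval M P x a),
            forall x, uval M P x = uval_loc M x (cond M P x)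
          & (P_X P).-integrable [set: borel X]
              (fun x => (psi x (uval M P x))%:E)],
      forall P, laws M P -> forall x a,
        (arm_law M P a x).-integrable [set: borel Wt] (EFin \o score M a) /\
        ('E_(arm_law M P a x)[score M a] = (uval M P x a)%:E)%E
    & trace_measurable_fun
        [set z : borel X * (vec R A * vec R A) * armset |
           [/\ N1 z.1.2.1, N2 z.1.2.2 & K0 z.2]] (psibar M) /\
      forall P, laws M P -> {ae P_X P, forall x,
        psi x (uval M P x) =
        psibar M (x, (uval M P x, propensity M P x), kappa P x)}].

(** [glues P Q E]: the kernel [Q] and the marginal of [P] define a law of the
    model, which moreover satisfies [E].  Laws are compared on measurable
    sets. *)
Definition glues (P : law) (Q : X -> probability obs R) (E : law -> Prop)
    : Prop :=
  exists P' : law, [/\ laws M P', P_X P' ≡μ P_X P,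
    {ae P_X P, forall x, cond M P' x ≡μ Q x} & E P'].

(** The kernel [Q] on [{C <= m}] and the baseline kernel elsewhere. *)
Definition localized (P : law) (m : nat) (Q : X -> probability obs R)
    : X -> probability obs R :=
  fun x => if cost M x (Q x) <= m%:R then Q x else cond M P x.

Definition cost_glues (P : law) (Q : X -> probability obs R)
    (E : law -> Prop) : Prop :=
  ((\int[P_X P]_x (cost M x (Q x))%:E < +oo)%E -> glues P Q E) /\
  forall m, glues P (localized P m Q) E.

Definition adm_graph : set (borel X * pprobability obs R) :=
  [set z | adm M z.1 z.2].

Definition standing_conditions : Prop :=
  [/\ [/\ measurable adm_graph,
          measurable_fun adm_graph
            (fun z => eta1_loc M z.1 z.2 : vec R A),
          measurable_fun adm_graph
            (fun z => eta2_loc M z.1 z.2 : vec R A),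
          measurable_fun adm_graph (fun z => kappa_loc M z.1 z.2 : armset)
        & forall x Q, adm M x Q ->
            [/\ N1 (eta1_loc M x Q), N2 (eta2_loc M x Q)
              & K0 (kappa_loc M x Q)]],
      forall P, laws M P -> forall B : set (borel X), measurable B ->
        (0 < P_X P B)%E -> exists P' : law,
          [/\ laws M P',
              forall E : set (borel X), measurable E ->
                P_X P' E = ((fine (P_X P B))^-1%:E * P_X P (E `&` B))%E,
              {ae P_X P, forall x, B x -> cond M P' x ≡μ cond M P x}
            & {ae P_X P, forall x, B x ->
                [/\ uval M P' x = uval M P x,
                    propensity M P' x = propensity M P x
                  & kappa P' x = kappa P x]}],
      [/\ measurable_fun adm_graph (fun z => cost M z.1 z.2),
          measurable_fun adm_graph (fun z => psi z.1 (uval_loc M z.1 z.2))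
        & forall x Q, adm M x Q -> 1 <= cost M x Q /\
            `|psi x (uval_loc M x Q)| <= cost M x Q],
      forall P, laws M P ->
        [/\ {ae P_X P, forall x, adm M x (cond M P x)},
            (\int[P_X P]_x (cost M x (cond M P x))%:E < +oo)%E
          & forall Q : X -> probability obs R,
              univ_measurable_fun R (Q : borel X -> pprobability obs R) ->
              {ae P_X P, forall x, adm M x (Q x)} ->
              cost_glues P Q (fun=> True)]
    & forall P, laws M P -> {ae P_X P, forall x,
        [/\ uval M P x = eta1_loc M x (cond M P x),
            propensity M P x = eta2_loc M x (cond M P x),
            kappa P x = kappa_loc M x (cond M P x)
          & psi x (uval M P x) = psi x (uval_loc M x (cond M P x))]}].

(** The conditional laws at [x] obtained from [P] by replacing the arm-[a] law
    by an admissible one. *)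
Definition arm_replacements (P : law) (a : A) (x : X)
    : set (probability obs R) :=
  [set Q | exists2 L, arm_adm D P a x L &
     arm_decomposition Q (propensity M P x)
       (fun b => if b == a then L else arm_law M P b x)].

Definition contamination_condition (P : law) : Prop :=
  forall a : A,
  [/\ {ae P_X P, forall x, forall (e : R) (nu L : probability (borel Wt) R),
        0 < e < 1 ->
        finitely_supported_on nu (supp (arm_law M P a x)) ->
        ('E_nu[score M a] = (uval M P x a)%:E)%E ->
        (forall B, measurable B ->
           L B = ((1 - e)%:E * arm_law M P a x B + e%:E * nu B)%E) ->
        arm_adm D P a x L},
      measurable [set z : borel X * pprobability obs R |
        arm_replacements P a z.1 z.2],
      {ae P_X P, forall x, arm_replacements P a x `<=` adm M x}
    & forall Q : X -> probability obs R,
        univ_measurable_fun R (Q : borel X -> pprobability obs R) ->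
        {ae P_X P, forall x, arm_replacements P a x (Q x)} ->
        cost_glues P Q (fun P' => {ae P_X P, forall x,
          [/\ uval M P' x = uval M P x, propensity M P' x = propensity M P x
            & kappa P' x = kappa P x]})].

Definition unit_dir (a : A) (t : R) : A -> R :=
  fun b => if b == a then t else 0.

(** [tie_path P x 0 = 0]: the path issues from the null direction, without
    which affineness along it would say nothing about the link at [u_P(x)]. *)
Definition direction_condition (P : law) : Prop :=
  [/\ measurable [set z : borel X * vec R A | dirs D P z.1 z.2],
      {ae P_X P, forall x, dirs D P x (fun=> 0)},
      measurable_fun [set: borel X] (relaxed D P : borel X -> armset),
      {ae P_X P, forall x, forall a, a \in relaxed D P x ->
        a \notin kappa P x /\
        \forall t \near (0 : R),
          a \notin active (link M) x (fun b => uval M P x b + unit_dir a t b) ->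
          dirs D P x (unit_dir a t)}
    & [/\ measurable_fun [set: borel X] (path_radius D P : borel X -> R),
          forall x, 0 < path_radius D P x,
          measurable_fun [set z : borel X * R | `|z.2| < path_radius D P z.1]
            (fun z => tie_path D P z.1 z.2 : vec R A)
        & {ae P_X P, forall x, tie_path D P x 0 = (fun=> 0) /\
            forall t, `|t| < path_radius D P x ->
            [/\ dirs D P x (tie_path D P x t),
                forall a, a \notin kappa P x -> tie_path D P x t a = 0
              & forall a, a \in kappa P x ->
                  link M x a (uval M P x a + tie_path D P x t a) =
                  link M x a (uval M P x a) + t]}]].

(** A selection of the laws [Q_{x,delta}] is given by its direction
    [delta(x)]; as [delta] is the shift of the arm score means and the graph is
    Borel, [x |-> Q_{x,delta(x)}] is universally measurable iff [delta] is. *)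
Definition shift_condition (P : law) : Prop :=
  [/\ {ae P_X P, forall x,
        shifted D P x (fun=> 0) ≡μ cond M P x /\
        forall delta, dirs D P x delta ->
        [/\ shifted D P x delta `<< cond M P x,
            exists2 L, arm_decomposition (shifted D P x delta)
                         (propensity M P x) L &
              forall a, (L a).-integrable [set: borel Wt]
                          (EFin \o score M a) /\
                ('E_(L a)[score M a] = (uval M P x a + delta a)%:E)%E,
            adm M x (shifted D P x delta),
            eta2_loc M x (shifted D P x delta) = propensity M P x
          & kappa_loc M x (shifted D P x delta) = kappa P x]},
      measurable [set z : borel X * pprobability obs R |
        exists2 delta, dirs D P z.1 delta &
          (z.2 : probability obs R) ≡μ shifted D P z.1 delta]
    & forall delta : X -> A -> R,
        univ_measurable_fun R (delta : borel X -> vec R A) ->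
        {ae P_X P, forall x, dirs D P x (delta x)} ->
        cost_glues P (fun x => shifted D P x (delta x))
          (fun P' => {ae P_X P, forall x,
             propensity M P' x = propensity M P x /\
             kappa P' x = kappa P x})].

Definition perturbation_conditions : Prop :=
  forall P, laws M P ->
    [/\ contamination_condition P, direction_condition P & shift_condition P].

Section score_class.
Variable Waux : ptopologicalType.

Local Notation args :=
  (borel X * obs * (vec R A * vec R A) * armset * borel Waux)%type.

(** The class [F_B].  The first disjunct is [j = 1], the second [j = 2]. *)
Definition F_B (f : args -> R) : Prop :=
  trace_measurable_fun
    [set z : args | [/\ N1 z.1.1.2.1, N2 z.1.1.2.2 & K0 z.1.2]] f /\
  forall P P', laws M P -> laws M P' ->
  forall w : X -> Waux, measurable_fun [set: borel X]
                          (w : borel X -> borel Waux) ->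
    {ae P_X P, forall x, propensity M P' x = propensity M P x} \/
    {ae P_X P, forall x, uval M P' x = uval M P x} ->
    let F := fun z : borel X * obs =>
      (f (z, (uval M P' z.1, propensity M P' z.1), kappa P z.1, w z.1))%:E in
    P.-integrable [set: borel X * obs] F /\ (\int[P]_z F z = target P)%E.

(** [f_w^P (x, (a, wt))]. *)
Definition at_law (f : args -> R) (P : law) (w : X -> Waux)
    (x : X) (o : obs) : R :=
  f (x, o, (uval M P x, propensity M P x), kappa P x, w x).

End score_class.

End model.

(* Main.v *)
(** Let [f] be a score of the class, [P] a law of the model and [F] the function
    [f_w^P].  If [P'] has the same marginal, propensities and active sets as
    [P], then the defining identity of the class, applied to the pair
    [(P', P)], computes the [P']-mean of [F]; applied to the restrictions of
    [P'] to Borel sets of covariates it gives, for almost every [x], that the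
    mean of [F (x, .)] under the conditional law of [P'] is the integrand of the
    target at [x].

    Contaminating arm [a] by two atoms [y1 x], [y2 x] of the support whose
    barycentre for the score is [u_a(x)] changes no nuisance, so the segment
    between the points [(h_a, F)] at [y1 x] and [y2 x] passes through the mean
    point [(u_a(x), C_a(x))].  Were [F] not almost surely affine in [h_a], the
    points off the line of slope [beta_a(x)] through the mean point would have
    positive measure for a nonnegligible set of [x], and a measurable selection
    of such points in the support would contradict this.

    Finally, shifting the arm means by [delta] changes the mean of the affine
    function [F (x, .)] by [sum_a pi_a beta_a delta_a] and the integrand by the
    increment of the maximum.  The increment is [0] when a single inactive arm
    moves a little, and [t] along the tie-preserving path, where
    [delta_a = t / g_a'] because the active links are affine there. *)

Require Import Defs.
From HB Require Import structures.
From mathcomp Require Import all_boot all_order all_algebra.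
From mathcomp Require Import all_classical all_reals all_analysis.
From mathcomp Require Import measurable_realfun giry ring lra.
Import Order.TTheory GRing.Theory Num.Theory.
Import numFieldNormedType.Exports.
Local Open Scope classical_set_scope.
Local Open Scope ring_scope.
Set Implicit Arguments.
Unset Strict Implicit.
Unset Printing Implicit Defensive.

(** * Disintegration *)

(** Measurable rectangles form a pi-system that generates the product sigma-algebra and contains the
    whole space. The measures are subprobabilities, the values of the Giry monad, so that the lemma
    applies to [joint_law]. *)
Lemma probability_unique d1 d2 (T1 : measurableType d1) (T2 : measurableType d2)
    (R : realType) (P Q : giry (T1 * T2)%type R) :
  (forall E B, measurable E -> measurable B -> P (E `*` B) = Q (E `*` B)) ->
  P ≡μ Q.
Proof.
move=> PQ S mS.
apply: (measure_unique [set A `*` B | A in measurable & B in measurable]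
  (fun=> setT)) => //.
- exact: measurable_prod_measurableType.
- move=> _ _ [A1 mA1 [A2 mA2 <-]] [B1 mB1 [B2 mB2 <-]].
  exists (A1 `&` B1); first exact: measurableI.
  by exists (A2 `&` B2); [exact: measurableI|rewrite setXI].
- by move=> _; exists setT => //; exists setT => //; rewrite setXTT.
- by rewrite bigcup_const.
- by move=> _ [A mA [B mB <-]]; exact: PQ.
- by move=> _; rewrite (le_lt_trans (@sprobability_setT _ _ _ P)) ?ltry.
Qed.

Section disintegration.
Context d1 d2 (T1 : measurableType d1) (T2 : measurableType d2) (R : realType).
Variables (P : probability (T1 * T2)%type R) (mu : probability T1 R).
Variable K : T1 -> probability T2 R.
Hypothesis mK : measurable_fun [set: T1] (K : T1 -> pprobability T2 R).

Local Open Scope ereal_scope.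

(** The law of [(x, y)] with [y] drawn from [K x]. *)
Let slice (x : T1) : giry (T1 * T2)%type R :=
  giry_map (pair1_measurable x) (K x).

Lemma measurable_kernel_section (A : set (T1 * T2)) : measurable A ->
  measurable_fun [set: T1] (fun x => K x (xsection A x)).
Proof.
move=> mA; apply: (measurable_fun_xsection_finite_kernel
  (kprobability mK)); by rewrite inE.
Qed.

Let mslice : measurable_fun [set: T1] slice.
Proof.
apply: measurable_giry_codensity => // A mA.
rewrite (_ : slice ^~ A = (fun x => K x (xsection A x))).
  exact: measurable_kernel_section.
by apply/funext => x; rewrite xsectionE.
Qed.

Lemma measurable_kernel_integral (F : T1 * T2 -> \bar R) :
  measurable_fun [set: T1 * T2] F ->
  measurable_fun [set: T1] (fun x => \int[K x]_y F (x, y)).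
Proof.
move=> mF; under eq_fun do rewrite integralE.
apply: emeasurable_funB.
- under eq_fun do under eq_integral do rewrite (funepos_comp F).
  apply: (measurable_fun_integral_finite_kernel F^\+ (kprobability mK)) => //.
  exact: measurable_funepos.
- under eq_fun do under eq_integral do rewrite (funeneg_comp F).
  apply: (measurable_fun_integral_finite_kernel F^\- (kprobability mK)) => //.
  exact: measurable_funeneg.
Qed.

(** The semidirect product of [mu] and [K], obtained as a bind in the Giry monad. *)
Definition joint_law : giry (T1 * T2)%type R := giry_bind mu mslice.

Lemma joint_lawE (A : set (T1 * T2)) : measurable A ->
  joint_law A = \int[mu]_x K x (xsection A x).
Proof.
move=> mA; rewrite /joint_law /giry_bind /= giry_int_map//; last first.
  exact: measurable_giry_ev.
by apply: eq_integral => x _; rewrite xsectionE.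
Qed.

Hypothesis PK : forall (E : set T1) (B : set T2), measurable E ->
  measurable B -> P (E `*` B) = (\int[mu]_(x in E) K x B)%E.

(** By [PK], [P] agrees with [joint_law] on rectangles, hence on all measurable sets; integrals
    against a Giry bind are iterated integrals. *)
Lemma ge0_integral_disintegration (F : T1 * T2 -> \bar R) :
  measurable_fun [set: T1 * T2] F -> (forall z, 0 <= F z) ->
  \int[P]_z F z = \int[mu]_x \int[K x]_y F (x, y).
Proof.
move=> mF F0.
have PB : (P : giry _ R) ≡μ joint_law.
  apply: probability_unique => E B mE mB; transitivity (P (E `*` B)) => //.
  rewrite PK// joint_lawE; last exact: measurableX.
  rewrite integral_mkcond; apply: eq_integral => x _; rewrite patchE.
  by case: ifPn => xE; [rewrite in_xsectionX|rewrite notin_xsectionX// measure0].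
transitivity (\int[joint_law]_z F z).
  by apply: eq_measure_integral => A mA _; exact: PB.
have := @giry_int_bind _ _ _ _ _ mu _ mslice F mF F0; rewrite /giry_int => ->.
apply: eq_integral => x _.
have := @giry_int_map _ _ _ _ _ _ (pair1_measurable x) (K x) F mF F0.
by rewrite /giry_int => ->.
Qed.

Variable F : T1 * T2 -> \bar R.
Hypothesis iF : P.-integrable [set: T1 * T2] F.

Let mF : measurable_fun [set: T1 * T2] F. Proof. exact: measurable_int iF. Qed.

Let mFx x : measurable_fun [set: T2] (fun y => F (x, y)).
Proof. exact: measurableT_comp. Qed.

Let abs_fin : \int[mu]_x \int[K x]_y `|F (x, y)| < +oo.
Proof.
case/integrableP : iF => _; rewrite ge0_integral_disintegration//.
exact: measurableT_comp.
Qed.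

(** The iterated integral of the absolute value is finite, so its inner integral is finite almost
    everywhere. *)
Lemma ae_integrable_disintegration :
  {ae mu, forall x, (K x).-integrable [set: T2] (fun y => F (x, y))}.
Proof.
have : mu.-integrable [set: T1] (fun x => \int[K x]_y `|F (x, y)|).
  apply/integrableP; split.
    apply: (@measurable_kernel_integral (abse \o F)).
    exact: measurableT_comp.
  under eq_integral do rewrite gee0_abs ?integral_ge0//.
  exact: abs_fin.
move/integrable_ae => /(_ measurableT); apply: filterS => x /(_ I) xfin.
by apply/integrableP; split => //; rewrite ltey_eq xfin.
Qed.

Lemma integrable_disintegration :
  mu.-integrable [set: T1] (fun x => \int[K x]_y F (x, y)).
Proof.
apply/integrableP; split; first exact: measurable_kernel_integral.
apply: le_lt_trans abs_fin; apply: ge0_le_integral => //.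
- apply: measurableT_comp => //; exact: measurable_kernel_integral.
- apply: (@measurable_kernel_integral (abse \o F)).
  exact: measurableT_comp.
- by move=> x _; apply: le_abse_integral.
Qed.

Lemma integral_disintegration :
  \int[P]_z F z = \int[mu]_x \int[K x]_y F (x, y).
Proof.
(* The positive and negative parts lie below the absolute value, so both have integrable inner
   integrals, which may be subtracted. *)
have key G : measurable_fun setT G -> (forall z, 0 <= G z) ->
    (forall z, G z <= `|F z|) ->
    mu.-integrable [set: T1] (fun x => \int[K x]_y G (x, y)).
  move=> mG G0 GF; apply/integrableP; split.
    exact: measurable_kernel_integral.
  under eq_integral do rewrite gee0_abs ?integral_ge0//.
  rewrite -ge0_integral_disintegration//.
  case/integrableP: iF => _; apply: le_lt_trans.
  by apply: ge0_le_integral => //; exact: measurableT_comp.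
rewrite integralE ge0_integral_disintegration//; last exact: measurable_funepos.
rewrite ge0_integral_disintegration//; last exact: measurable_funeneg.
rewrite -integralB//.
- apply: eq_integral => x _; rewrite [RHS]integralE; congr (_ - _).
    by apply: eq_integral => y _; rewrite !funeposE.
  by apply: eq_integral => y _; rewrite !funenegE.
- apply: key => [|//|z]; first exact: measurable_funepos.
  by rewrite -/((abse \o F) z) fune_abse leeDl.
- apply: key => [|//|z]; first exact: measurable_funeneg.
  by rewrite -/((abse \o F) z) fune_abse leeDr.
Qed.

End disintegration.

(** * Finite mixtures *)

Section mixture.
Context d (T : measurableType d) (R : realType) (I : finType).
Implicit Types (p : I -> R) (m : I -> probability T R).
Local Open Scope ereal_scope.

Definition is_mixture (Q : set T -> \bar R) p m :=
  forall E, measurable E -> Q E = \sum_i (p i)%:E * m i E.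

(** [msum] adds a sequence of measures, so the elements of [I] are listed by [enum_val], with the
    zero measure past the last one. The absolute value provides a nonnegative scaling factor and
    disappears for nonnegative weights. *)
Let summand p m (n : nat) : {measure set T -> \bar R} :=
  if insub n is Some k then
    mscale (`|p (enum_val (k : 'I_#|I|))|%:nng)%R (m (enum_val k))
      : {measure set T -> \bar R}
  else mzero.

Definition mixture p m : set T -> \bar R := msum (summand p m) #|I|.

HB.instance Definition _ p m := Measure.on (mixture p m).

Let big_summand (F : {measure set T -> \bar R} -> \bar R) p m :
  \sum_(n < #|I|) F (summand p m n) =
  \sum_i F (mscale (`|p i|%:nng)%R (m i)).
Proof.
rewrite (big_enum_val (A := I)) /=.
by apply: eq_bigr => k _; rewrite /summand valK.
Qed.

Lemma mixtureE p m E : (forall i, (0 <= p i)%R) ->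
  mixture p m E = \sum_i (p i)%:E * m i E.
Proof.
move=> p0; have /= := big_summand (fun mu => mu E) p m.
rewrite /mixture /= /msum => ->.
by apply: eq_bigr => i _; rewrite /mscale /= ger0_norm.
Qed.

Section mixture_probability.
Variables (p : I -> R) (m : I -> probability T R).
Hypothesis p01 : (forall i, (0 <= p i)%R) /\ (\sum_i p i = 1)%R.

Let mixture_setT : mixture p m setT = 1.
Proof.
rewrite mixtureE; last exact: p01.1.
under eq_bigr do rewrite probability_setT mule1.
by rewrite sumEFin p01.2.
Qed.

HB.instance Definition _ :=
  Measure_isProbability.Build _ _ _ (mixture p m) mixture_setT.

Definition mixture_probability : probability T R := mixture p m.

End mixture_probability.

Section mixture_integral.
Variables (Q : {measure set T -> \bar R}) (p : I -> R) (m : I -> probability T R).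
Hypotheses (p0 : forall i, (0 <= p i)%R) (Qpm : is_mixture Q p m).

Lemma ge0_integral_mixture f : measurable_fun [set: T] f -> (forall t, 0 <= f t) ->
  \int[Q]_t f t = \sum_i (p i)%:E * \int[m i]_t f t.
Proof.
move=> mf f0; transitivity (\int[mixture p m]_t f t).
  by apply: eq_measure_integral => E mE _; rewrite Qpm//; exact/esym/mixtureE.
rewrite ge0_integral_measure_sum//.
have /= -> := big_summand
  (fun mu : {measure set T -> \bar R} => \int[mu]_t f t) p m.
by apply: eq_bigr => i _; rewrite ge0_integral_mscale//= ger0_norm.
Qed.

Variable f : T -> \bar R.

Lemma integrable_mixture :
  (forall i, (m i).-integrable [set: T] f) ->
  measurable_fun [set: T] f -> Q.-integrable [set: T] f.
Proof.
move=> mf mf'; apply/integrableP; split => //.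
rewrite ge0_integral_mixture//; last exact: measurableT_comp.
apply/lte_sum_pinfty => i _; apply: lte_mul_pinfty; rewrite ?lee_fin//.
by case/integrableP: (mf i).
Qed.

Lemma integrable_component i : (0 < p i)%R ->
  Q.-integrable [set: T] f -> (m i).-integrable [set: T] f.
Proof.
move=> pi0 iQ; apply/integrableP; split; first exact: measurable_int iQ.
case/integrableP: iQ => mf; rewrite ge0_integral_mixture//; last first.
  exact: measurableT_comp.
(* An infinite integral in a component of positive weight would make the whole sum infinite, as no
   other term is negative. *)
rewrite (bigD1 i)//=; rewrite lt_neqAle => /andP[+ _].
apply: contraTT; rewrite -leNgt leye_eq => /eqP ->.
rewrite gt0_muley ?lte_fin// negbK addye// gt_eqF//.
rewrite (@lt_le_trans _ _ 0) ?ltNy0// sume_ge0// => j _.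
by rewrite mule_ge0// ?lee_fin// integral_ge0.
Qed.

Lemma integral_mixture :
  (forall i, (m i).-integrable [set: T] f) -> measurable_fun [set: T] f ->
  \int[Q]_t f t = \sum_i (p i)%:E * \int[m i]_t f t.
Proof.
move=> im mf; rewrite integralE ge0_integral_mixture//; last first.
  exact: measurable_funepos.
rewrite ge0_integral_mixture//; last exact: measurable_funeneg.
rewrite -sumeN; last first.
  move=> i j _ _; apply: fin_num_adde_defr; rewrite fin_numM//.
  exact: integrable_neg_fin_num (im _).
rewrite -big_split; apply: eq_bigr => i _ /=.
rewrite [in RHS]integralE [RHS]muleBr//.
by apply: fin_num_adde_defl; rewrite ?fin_numN; exact: integrable_neg_fin_num (im _).
Qed.

End mixture_integral.
End mixture.

Section convex_pair.
Context d (T : measurableType d) (R : realType) (q : R).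
Hypothesis q01 : 0 <= q <= 1.
Variables m1 m2 : probability T R.

Let weight (b : bool) := if b then q else 1 - q.

Let weight01 : (forall b, 0 <= weight b) /\ \sum_b weight b = 1.
Proof.
case/andP: q01 => q0 q1; split=> [[]|]; rewrite ?big_bool /weight ?subr_ge0//.
by rewrite /= addrCA subrr addr0.
Qed.

Definition convex_pair : probability T R :=
  mixture_probability (fun b : bool => if b then m1 else m2) weight01.

Lemma convex_pairE E : convex_pair E = (q%:E * m1 E + (1 - q)%:E * m2 E)%E.
Proof.
transitivity (mixture weight (fun b : bool => if b then m1 else m2) E) => //.
by rewrite mixtureE ?big_bool//; exact: weight01.1.
Qed.

Let convex_pair_mixture :
  is_mixture convex_pair weight (fun b : bool => if b then m1 else m2).
Proof. by move=> E mE; rewrite convex_pairE big_bool. Qed.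

Variable f : T -> R.
Hypotheses (f1 : m1.-integrable [set: T] (EFin \o f))
  (f2 : m2.-integrable [set: T] (EFin \o f)).

Lemma integrable_convex_pair : convex_pair.-integrable [set: T] (EFin \o f).
Proof.
apply: (integrable_mixture _ convex_pair_mixture); first exact: weight01.1.
- by case.
- exact: measurable_int f1.
Qed.

Lemma integral_convex_pair : (\int[convex_pair]_t (f t)%:E =
  q%:E * \int[m1]_t (f t)%:E + (1 - q)%:E * \int[m2]_t (f t)%:E)%E.
Proof.
rewrite (integral_mixture _ convex_pair_mixture); first by rewrite big_bool.
- exact: weight01.1.
- by case.
- exact: measurable_int f1.
Qed.

End convex_pair.

Lemma integrable_dirac d (T : measurableType d) (R : realType) (y : T)
    (f : T -> R) : measurable_fun [set: T] f ->
  (\d_y : {measure set T -> \bar R}).-integrable [set: T] (EFin \o f).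
Proof.
move=> mf; have mf' : measurable_fun [set: T] (EFin \o f).
  exact/measurable_EFinP.
apply/integrableP; split=> //.
rewrite integral_dirac//; last exact: measurableT_comp.
by rewrite diracT mul1e ltry.
Qed.

(** The sigma-algebra of [pprobability] is generated by evaluations on measurable sets. *)
Lemma measurable_pprobability d1 d2 (T1 : measurableType d1)
    (T2 : measurableType d2) (R : realType) (K : T1 -> probability T2 R) :
  (forall E : set T2, measurable E -> measurable_fun [set: T1] (fun x => K x E)) ->
  measurable_fun [set: T1] (K : T1 -> pprobability T2 R).
Proof.
move=> mK; apply: (measurability (@pset _ T2 R : set (set (pprobability T2 R)))).
  by [].
move=> _ [_ [r r01 [E mE <-]] <-]; apply: measurable_lte => //; exact: mK.
Qed.

Lemma measurable_pprobabilityE d1 d2 (T1 : measurableType d1)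
    (T2 : measurableType d2) (R : realType) (K : T1 -> probability T2 R)
    (E : set T2) : measurable_fun [set: T1] (K : T1 -> pprobability T2 R) ->
  measurable E -> measurable_fun [set: T1] (fun x => K x E).
Proof. by move=> mK mE; exact: (measurable_kernel (kprobability mK)). Qed.

(** * Conditional laws of the observation *)

HB.instance Definition _ d1 d2 (T1 : measurableType d1)
    (T2 : measurableType d2) (x : T1) :=
  isMeasurableFun.Build _ _ T2 (T1 * T2)%type (pair x) (pair1_measurable x).

Lemma discrete_measurable (T : pointedType) (E : set (discrete T)) :
  measurable E.
Proof. exact: sub_sigma_algebra. Qed.

Section arms.
Context (R : realType) (A : pfinType) (Wt : ptopologicalType).
Local Notation obs := (obs A Wt).
Implicit Types (Q : probability obs R) (p : A -> R)
  (L : A -> probability (borel Wt) R).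

Definition at_arm L (a : A) : probability obs R :=
  distribution (L a) (pair (a : discrete A)).

(** A measurable set is the disjoint union over the arms of [{a}] times its section at [a]. *)
Lemma arm_mixture Q p L :
  arm_decomposition Q p L -> is_mixture Q p (at_arm L).
Proof.
move=> dQ E mE.
have mEx (a : discrete A) : measurable (pair a @^-1` E : set (borel Wt)).
  by rewrite -xsectionE; exact: measurable_xsection.
have mEa a : measurable ([set (a : discrete A)] `*` (pair a @^-1` E)).
  by apply: measurableX => //; exact: discrete_measurable.
have EU : E = \bigcup_(a in [set` index_enum A])
    ([set (a : discrete A)] `*` (pair a @^-1` E)).
  apply/seteqP; split => [[a t] Eat|[b t] [a _ [/= ->]]//].
  by exists a => //=; exact: mem_index_enum.
rewrite {1}EU measure_fin_bigcup.
- rewrite -fsbig_seq ?index_enum_uniq//=; apply: eq_bigr => a _.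
  by rewrite dQ//; exact: mEx.
- exact: finite_seq.
- move=> a b _ _ [[c t] [/= [-> _] [-> _]]] //.
- by move=> a _; exact: mEa.
Qed.

Lemma arm_decompositionP Q p L : is_mixture Q p (at_arm L) ->
  arm_decomposition Q p L.
Proof.
move=> QL a B mB; rewrite QL; last exact: measurableX (discrete_measurable _) mB.
rewrite (bigD1 a)//= big1 ?adde0.
  congr (_ * L a _)%E; apply/seteqP.
  by split => [t []|t Bt] //; split.
move=> b ba; rewrite (_ : at_arm L b _ = 0%E) ?mule0//.
rewrite -[LHS]/(L b _) (_ : _ @^-1` _ = set0) ?measure0//.
by apply/seteqP; split => [t [/= bE]|//]; rewrite bE eqxx in ba.
Qed.

Lemma arm_decomposition_sum1 Q p L : arm_decomposition Q p L -> \sum_a p a = 1.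
Proof.
move/arm_mixture => /(_ _ measurableT).
rewrite probability_setT; under eq_bigr do rewrite probability_setT mule1.
by rewrite sumEFin => -[->].
Qed.

(** Evaluation on [{a}] times the whole space identifies the weights; since they are positive, they
    can then be divided out. *)
Lemma arm_decomposition_unique Q Q' p p' L L' : (forall a, 0 < p a) ->
  Q ≡μ Q' -> arm_decomposition Q p L -> arm_decomposition Q' p' L' ->
  p = p' /\ forall a, L a ≡μ L' a.
Proof.
move=> p0 QQ' dQ dQ'.
have QQS S : measurable S -> Q S = Q' S := QQ' S.
have eqp : p = p'.
  apply/funext => a; have := QQS ([set (a : discrete A)] `*` setT).
  rewrite dQ// dQ'// !probability_setT !mule1 => pp.
  by apply: EFin_inj; apply: pp; apply: measurableX (discrete_measurable _) _.
split => // a B mB; have := QQS ([set (a : discrete A)] `*` B).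
rewrite dQ// dQ'// -eqp => pp.
have /pp : measurable ([set (a : discrete A)] `*` B).
  exact: measurableX (discrete_measurable _) mB.
have pa : (p a)%:E \is a fin_num by [].
have la : L a B \is a fin_num by exact: fin_num_measure.
have la' : L' a B \is a fin_num by exact: fin_num_measure.
rewrite -(fineK la) -(fineK la') -!EFinM => -[] /mulfI e.
suff : L a B = L' a B by [].
by rewrite -(fineK la) -(fineK la') e// gt_eqF.
Qed.

Section arm_integral.
Variables (Q : probability obs R) (p : A -> R) (L : A -> probability (borel Wt) R).
Hypotheses (p0 : forall a, 0 < p a) (dQ : arm_decomposition Q p L).
Variable f : obs -> \bar R.
Hypothesis mf : measurable_fun [set: obs] f.
Local Open Scope ereal_scope.

Lemma integrable_at_arm a : (at_arm L a).-integrable [set: obs] f <->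
  (L a).-integrable [set: borel Wt] (fun t => f (a, t)).
Proof.
have mfa : measurable_fun [set: borel Wt] (fun t => f (a, t)).
  exact: (measurableT_comp mf (pair1_measurable (a : discrete A))).
split=> /integrableP[_ fa]; apply/integrableP; split => //; move: fa;
by rewrite ge0_integral_distribution//; exact: measurableT_comp.
Qed.

Lemma arm_integrable a : Q.-integrable [set: obs] f ->
  (L a).-integrable [set: borel Wt] (fun t => f (a, t)).
Proof.
move=> iQ; apply/integrable_at_arm.
by apply: (integrable_component _ (arm_mixture dQ)) iQ => // b; exact/ltW.
Qed.

Hypothesis fL : forall a,
  (L a).-integrable [set: borel Wt] (fun t => f (a, t)).

Lemma integral_arm :
  \int[Q]_o f o = \sum_a (p a)%:E * \int[L a]_t f (a, t).
Proof.
rewrite (integral_mixture _ (arm_mixture dQ))//.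
- by apply: eq_bigr => a _; rewrite integral_distribution.
- by move=> b; exact/ltW.
- by move=> b; apply/integrable_at_arm.
Qed.

End arm_integral.

End arms.

(** * The score identity for almost every covariate *)

Lemma ae_dominated d (T : measurableType d) (R : realType)
    (m1 m2 : {measure set T -> \bar R}) (Q : T -> Prop) :
  (forall N, measurable N -> m1 N = 0%E -> m2 N = 0%E) ->
  {ae m1, forall x, Q x} -> {ae m2, forall x, Q x}.
Proof. by move=> m12 [N [mN N0 NQ]]; exists N; split => //; exact: m12. Qed.

(* Statements about almost every [x : X], rather than [x : borel X], hide the
   measurable structure from the library's hint for this instance. *)
Lemma borel_ae_filter (R : realType) (X : ptopologicalType)
    (m : {measure set (borel X) -> \bar R}) :
  Filter (nbhs (almost_everywhere m : set_system X)).
Proof. exact: (ae_filter_ringOfSetsType m). Qed.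

#[local] Hint Extern 0 (Filter (nbhs (almost_everywhere _))) =>
  (apply: borel_ae_filter) : typeclass_instances.

Lemma ae_absurd d (T : measurableType d) (R : realType) (m : probability T R) :
  ~ {ae m, forall x, False}.
Proof.
move=> [N [mN N0 NQ]]; have NT : N = setT.
  by apply/seteqP; split => // x _; apply: NQ.
by move: N0; rewrite NT probability_setT => /eqP; rewrite onee_eq0.
Qed.

Section integral_comparison.
Context d (T : measurableType d) (R : realType) (m : probability T R).
Local Open Scope ereal_scope.

Lemma ae_eq_integrable (f g : T -> \bar R) : measurable_fun [set: T] g ->
  {ae m, forall x, f x = g x} -> m.-integrable [set: T] f ->
  m.-integrable [set: T] g.
Proof.
move=> mg fg /integrableP[mf f1]; apply/integrableP; split => //.
apply: le_lt_trans f1; rewrite le_eqVlt; apply/orP; left; apply/eqP.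
apply: ge0_ae_eq_integral => //; [exact: measurableT_comp..|].
by apply: filterS fg => x -> _.
Qed.

(** Equal integrals would give the almost surely positive difference a zero integral, so it would
    also vanish almost everywhere, which a probability excludes. *)
Lemma ae_lt_integral_neq (f g : T -> \bar R) : m.-integrable [set: T] f ->
  m.-integrable [set: T] g -> {ae m, forall x, f x < g x} ->
  \int[m]_x f x <> \int[m]_x g x.
Proof.
move=> fi gi fg fgE.
have iB : m.-integrable [set: T] (g \- f) by exact: integrableB.
have : \int[m]_x `|(g \- f) x| = 0.
  transitivity (\int[m]_x (g \- f) x).
    apply: ae_eq_integral => //.
    - by apply: measurableT_comp => //; exact: measurable_int iB.
    - exact: measurable_int iB.
    - move: fg (integrable_ae measurableT fi).
      apply: filterS2 => x fgx /(_ I) fx _.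
      by rewrite gee0_abs// sube_ge0 ?fx//= ltW.
  by rewrite integralB// fgE subee// integrable_fin_num.
move/(ae_eq_integral_abs m measurableT (measurable_int _ iB)) => gf0.
apply: (@ae_absurd _ _ _ m).
have := integrable_ae measurableT fi.
move: gf0 fg; apply: filterS3 => x /(_ I) /= gf0 fgx /(_ I) ffin.
move: fgx; rewrite -sube_gt0 => //.
by rewrite gf0 ltxx.
Qed.

End integral_comparison.

Section measure_eq_integral.
Context d (T : measurableType d) (R : realType).
Variables (m1 m2 : {measure set T -> \bar R}).
Hypothesis m12 : m1 ≡μ m2.

Lemma measure_eq_integral (f : T -> \bar R) :
  (\int[m1]_x f x = \int[m2]_x f x)%E.
Proof. by apply: eq_measure_integral => S mS _; exact: m12. Qed.

Lemma measure_eq_integrable (f : T -> \bar R) :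
  m1.-integrable [set: T] f -> m2.-integrable [set: T] f.
Proof.
by move=> /integrableP[mf]; rewrite measure_eq_integral => ?; exact/integrableP.
Qed.

End measure_eq_integral.

Lemma measure_eq_expectation d (T : measurableType d) (R : realType)
    (m1 m2 : probability T R) (f : T -> R) :
  m1 ≡μ m2 -> ('E_m1[f] = 'E_m2[f])%E.
Proof. by move=> m12; rewrite unlock; exact: measure_eq_integral. Qed.

Section score_identity.
Context (R : realType) (A : pfinType) (X Wt Waux : ptopologicalType).
Variables (M : max_arm_model R A X Wt).
Hypotheses (structM : max_arm_structure M) (standM : standing_conditions M).
Variable f : borel X * obs A Wt * (vec R A * vec R A) * discrete {set A}
         * borel Waux -> R.
Hypothesis fFB : F_B M f.
Variable w : X -> Waux.
Hypothesis mw : measurable_fun [set: borel X] (w : borel X -> borel Waux).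
Variable P : law R A X Wt.
Hypothesis MP : laws M P.
Local Notation law := (law R A X Wt).
Local Notation obs := (obs A Wt).

Let phi (x : X) (o : obs) : \bar R := (at_law M f P w x o)%:E.

Lemma measurable_at_law : measurable_fun [set: borel X * obs]
  (fun z : borel X * obs => phi z.1 z.2).
Proof.
have [_ /(_ P P MP MP w mw)] := fFB.
case; first by left; exact/aeW.
move=> /measurable_int /=; set F := fun _ => _.
by rewrite (_ : F = (fun z => phi z.1 z.2))//; apply/funext => -[].
Qed.

Lemma measurable_at_law_section x : measurable_fun [set: obs] (phi x).
Proof.
exact: (measurableT_comp measurable_at_law (pair1_measurable (x : borel X))).
Qed.

(** The marginal of [P''] is that of [P'] conditioned on [B]. Hence a property that holds almost
    everywhere on [B] for [P'] holds almost everywhere for [P'']. *)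
Lemma restricted_law (P' : law) (B : set (borel X)) : laws M P' ->
  measurable B -> (0 < marginal P' B)%E ->
  exists P'' : law, [/\ laws M P'',
    forall Q : X -> Prop, {ae marginal P', forall x, B x -> Q x} ->
      {ae marginal P'', forall x, Q x}
    & {ae marginal P'', forall x, [/\ B x, cond M P'' x ≡μ cond M P' x,
        uval M P'' x = uval M P' x, propensity M P'' x = propensity M P' x
        & kappa M P'' x = kappa M P' x]}].
Proof.
move=> MP' mB B0.
case: standM => _ /(_ _ MP' _ mB B0)[P'' [MP'' P''E c u]] _ _ _.
have transfer (Q : X -> Prop) : {ae marginal P', forall x, B x -> Q x} ->
    {ae marginal P'', forall x, Q x}.
  move=> [N [mN N0 NQ]]; exists (N `|` ~` B); split.
  - by apply: measurableU => //; exact: measurableC.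
  - rewrite P''E; last by apply: measurableU => //; exact: measurableC.
    rewrite setIUl setICl setU0 (_ : marginal P' (N `&` B) = 0%E) ?mule0//.
    apply/eqP; rewrite eq_le measure_ge0 andbT -N0 le_measure ?inE//.
    exact: measurableI.
  - move=> x nQ; have [Bx|nBx] := pselect (B x); last by right.
    by left; apply: NQ => /= /(_ Bx).
exists P''; split => //; apply: transfer.
by move: c u; apply: filterS2 => x /[swap] + + Bx => /(_ Bx)[? ? ?] /(_ Bx).
Qed.

Section law_identity.
Variable P' : law.
Hypothesis MP' : laws M P'.
Hypothesis agree : {ae marginal P', forall x,
  propensity M P' x = propensity M P x /\ kappa M P' x = kappa M P x}.

Let g (x : X) : \bar R := (\int[cond M P' x]_o phi x o)%E.

Lemma measurable_cond_integral : measurable_fun [set: borel X] g.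
Proof.
case: structM => _ /(_ _ MP')[[mK _] _ _ _ _] _ _ _.
exact: (measurable_kernel_integral mK measurable_at_law).
Qed.

(** The identity of the class is used with [P'] as the integrating law and [P] as the source of the
    nuisances. It evaluates [f] at the active set of [P'], so equality of [kappa] is what turns the
    integrand into [phi]. *)
Lemma law_identity :
  [/\ {ae marginal P', forall x, (cond M P' x).-integrable setT (phi x)},
      (marginal P').-integrable [set: borel X] g
    & (\int[marginal P']_x g x = \int[marginal P']_x (psi M x (uval M P' x))%:E)%E].
Proof.
case: structM => _ /(_ _ MP')[[mK PK] _ _ _ _] _ _ _.
have [_ /(_ P' P MP' MP w mw)] := fFB.
case.
  by left; apply: filterS agree => x [].
set F := fun z : borel X * obs => _; move=> iF FE.
have FP (x : X) : kappa M P' x = kappa M P x -> (fun o => F (x, o)) = phi x.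
  by move=> /= kE; apply/funext => o; rewrite /F /= kE.
have aeFP : {ae marginal P', forall x, (fun o => F (x, o)) = phi x}.
  by apply: filterS agree => x [_]; exact: FP.
have iP := ae_integrable_disintegration mK PK iF.
have ig := integrable_disintegration mK PK iF.
have gE := integral_disintegration mK PK iF.
split.
- by move: aeFP iP; apply: filterS2 => x ->.
- apply: ae_eq_integrable ig; first exact: measurable_cond_integral.
  by apply: filterS aeFP => x; rewrite /g => ->.
- rewrite -[RHS]FE gE; apply: ae_eq_integral => //.
  + exact: measurable_cond_integral.
  + exact: measurable_int ig.
  + by apply: filterS aeFP => x xE _; rewrite /g xE.
Qed.

End law_identity.

(** If one side exceeded the other on a set of positive measure, the restriction of [P'] to that set
    would be a law of the model violating the averaged identity. *)
Lemma pointwise_identity (P' : law) : laws M P' ->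
  {ae marginal P', forall x,
    propensity M P' x = propensity M P x /\ kappa M P' x = kappa M P x} ->
  {ae marginal P', forall x, (cond M P' x).-integrable setT (phi x) /\
    (\int[cond M P' x]_o phi x o = (psi M x (uval M P' x))%:E)%E}.
Proof.
move=> MP' agree; have [iP _ _] := law_identity MP' agree.
pose g x := (\int[cond M P' x]_o phi x o)%E.
pose h x := (psi M x (uval M P' x))%:E.
have mg : measurable_fun [set: borel X] g by exact: measurable_cond_integral.
have psi_int P1 : laws M P1 -> (marginal P1).-integrable [set: borel X]
    (fun x => (psi M x (uval M P1 x))%:E).
  by move=> MP1; case: structM => _ _ /(_ _ MP1)[].
have mh : measurable_fun [set: borel X] h by exact: measurable_int (psi_int _ MP').
have null (B : set (borel X)) : measurable B ->
    (forall x, B x -> (g x < h x)%E) \/ (forall x, B x -> (h x < g x)%E) ->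
    marginal P' B = 0%E.
  move=> mB Bgh; apply/eqP/negPn; rewrite -measure_gt0; apply/negP => B0.
  have [P'' [MP'' transfer agB]] := restricted_law MP' mB B0.
  have ag : {ae marginal P'', forall x,
      propensity M P'' x = propensity M P x /\ kappa M P'' x = kappa M P x}.
    have /transfer : {ae marginal P', forall x, B x ->
       propensity M P' x = propensity M P x /\ kappa M P' x = kappa M P x}.
      by apply: filterS agree.
    by move: agB; apply: filterS2 => x [_ _ _ -> ->].
  have [_ ig gE] := law_identity MP'' ag.
  have gE'' : {ae marginal P'', forall x, B x /\
      (\int[cond M P'' x]_o phi x o = g x /\
       (psi M x (uval M P'' x))%:E = h x)%E}.
    apply: filterS agB => x [Bx cE uE _ _]; split => //; split.
      by apply: eq_measure_integral => S mS _; exact: cE.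
    by rewrite /h uE.
  case: Bgh => Bgh.
  - apply: ae_lt_integral_neq ig (psi_int _ MP'') _ gE.
    by apply: filterS gE'' => x [Bx [-> ->]]; exact: Bgh.
  - apply: ae_lt_integral_neq (psi_int _ MP'') ig _ (esym gE).
    by apply: filterS gE'' => x [Bx [-> ->]]; exact: Bgh.
suff gh : {ae marginal P', forall x, g x = h x}.
  by move: iP gh; apply: filterS2.
have neg (B : set (borel X)) : measurable B ->
    (forall x, B x -> (g x < h x)%E) \/ (forall x, B x -> (h x < g x)%E) ->
    (marginal P').-negligible B.
  by move=> mB Bgh; exists B; split => //; exact: null.
apply: (negligibleS _ (negligibleU
  (neg [set x | g x < h x]%E _ _) (neg [set x | h x < g x]%E _ _))) => //.
- by move=> x /= /eqP; rewrite neq_lt => /orP[]; [left|right].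
- by rewrite -[X in measurable X]setTI; exact: measurable_lte.
- by left.
- by rewrite -[X in measurable X]setTI; exact: measurable_lte.
- by right.
Qed.

(** Both nuisances are functions of the conditional law: the arm weights, and the arm score means.
    So the nuisances of a glued law can be read off its kernel. *)
Lemma cond_nuisance (P' : law) x (Q : probability obs R) L v :
  laws M P' -> cond M P' x ≡μ Q ->
  arm_decomposition Q (propensity M P x) L ->
  (forall a, 'E_(L a)[score M a] = (v a)%:E)%E ->
  propensity M P' x = propensity M P x /\ uval M P' x = v.
Proof.
move=> MP' cQ dQ vE.
case: structM => _ /(_ _ MP')[_ _ _ /(_ x) dP' /(_ x) p0] _ /(_ _ MP' x) uE _.
have [-> LE] := arm_decomposition_unique p0 cQ dP' dQ; split => //.
apply/funext => a; apply: EFin_inj; rewrite -vE -(uE a).2.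
exact: measure_eq_expectation.
Qed.

(** Passes from gluing of the localized kernels to the identity for [Q] itself. The last hypothesis
    leaves to each application the proof that the active set is preserved, given the two possible
    values of [uval]. *)
Lemma glued_identity (Q : X -> probability obs R) (E : law -> Prop)
    (v : X -> A -> R) :
  (forall m, glues M P (localized M P m Q) E) ->
  {ae marginal P, forall x, exists2 L,
    arm_decomposition (Q x) (propensity M P x) L &
    forall a, ('E_(L a)[score M a] = (v x a)%:E)%E} ->
  (forall P', laws M P' -> E P' -> {ae marginal P, forall x,
     uval M P' x = v x \/ uval M P' x = uval M P x} ->
     {ae marginal P, forall x, kappa M P' x = kappa M P x}) ->
  {ae marginal P, forall x, (Q x).-integrable setT (phi x) /\
    (\int[Q x]_o phi x o = (psi M x (v x))%:E)%E}.
Proof.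
move=> gQ dQ kE.
(* The identity is first proved where the cost is at most [m]. Every point has a real cost, hence
   lies in one of these sets, and countably many null sets are discarded. *)
suff H m : {ae marginal P, forall x, cost M x (Q x) <= m%:R ->
    (Q x).-integrable setT (phi x) /\
    (\int[Q x]_o phi x o = (psi M x (v x))%:E)%E}.
  have := ae_foralln H; apply: filterS => x Hx.
  by apply: (Hx (Num.truncn (cost M x (Q x))).+1); exact/ltW/truncnS_gt.
have [P' [MP' XP' cP' EP']] := gQ m.
have PP' (S : X -> Prop) : {ae marginal P, forall x, S x} ->
    {ae marginal P', forall x, S x}.
  by apply: ae_dominated => N mN N0; rewrite -N0; exact: XP'.
have P'P (S : X -> Prop) : {ae marginal P', forall x, S x} ->
    {ae marginal P, forall x, S x}.
  by apply: ae_dominated => N mN N0; rewrite -N0; exact/esym/XP'.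
(* Where the cost exceeds [m] the kernel is the baseline one, whence the alternative
   [uval M P' x = uval M P x]. *)
have nuis : {ae marginal P, forall x,
    (cost M x (Q x) <= m%:R -> cond M P' x ≡μ Q x /\ uval M P' x = v x) /\
    (propensity M P' x = propensity M P x /\
     (uval M P' x = v x \/ uval M P' x = uval M P x))}.
  move: cP' dQ; apply: filterS2 => x + [L dL vL].
  rewrite /localized; case: ifPn => _ cE.
    by have [pE uE] := cond_nuisance MP' cE dL vL; split=> //; split=> //; left.
  case: structM => _ /(_ _ MP)[_ _ _ /(_ x) dP _] _ /(_ _ MP x) uE _.
  have [pE vE] := cond_nuisance MP' cE dP (fun a => (uE a).2).
  by split=> //; split=> //; right.
have kP' : {ae marginal P, forall x, kappa M P' x = kappa M P x}.
  by apply: kE EP' _ => //; apply: filterS nuis => x [_ []].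
have agree : {ae marginal P, forall x,
    propensity M P' x = propensity M P x /\ kappa M P' x = kappa M P x}.
  by move: nuis kP'; apply: filterS2 => x [_ []].
move: nuis (P'P _ (pointwise_identity MP' (PP' _ agree))).
apply: filterS2 => x [Hx _] [iP' PE] cm.
have [cE <-] := Hx cm; split; first exact: (measure_eq_integrable cE).
by rewrite -PE; apply/esym/measure_eq_integral.
Qed.

End score_identity.

(** * Measurable selection in Polish spaces *)

Section distance.
Context (R : realType) (Y : ptopologicalType) (dist : Y -> Y -> R).
Hypotheses (dist0 : forall x y, dist x y = 0 <-> x = y)
  (distC : forall x y, dist x y = dist y x)
  (dist_triangle : forall x y z, dist x z <= dist x y + dist y z)
  (nbhs_dist : forall x (U : set Y), nbhs x U <->
    exists2 e : R, 0 < e & [set y | dist x y < e] `<=` U).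

Lemma distxx x : dist x x = 0. Proof. exact/dist0. Qed.

Lemma open_distP (U : set Y) : open U <->
  forall x, U x -> exists2 e : R, 0 < e & [set y | dist x y < e] `<=` U.
Proof.
rewrite openE; split=> UU x Ux; first exact/nbhs_dist/UU.
exact/nbhs_dist/UU.
Qed.

Lemma cvg_distP (s : nat -> Y) (l : Y) : s @ \oo --> l <->
  forall e : R, 0 < e -> exists N : nat, forall n, (N <= n)%N -> dist l (s n) < e.
Proof.
split=> [sl e e0|sl U /nbhs_dist[e e0 eU]].
  have /sl[N _ Ns] : nbhs l [set y | dist l y < e] by apply/nbhs_dist; exists e.
  by exists N => n; exact: Ns.
by have [N Ns] := sl _ e0; exists N => // n /= Nn; apply: eU; exact: Ns.
Qed.

Lemma closed_dist_ball c (r : R) : closed [set y | dist c y <= r].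
Proof.
rewrite -openC; apply/open_distP => x /= /negP; rewrite -ltNge => rx.
exists (dist c x - r); first by rewrite subr_gt0.
move=> y /= xy; apply/negP; rewrite -ltNge.
have := dist_triangle c y x; rewrite (distC y x) => ?; lra.
Qed.

(** The points at distance at least [1/(k+1)] from the complement of [U]: closed subsets that
    exhaust [U] when it is open. *)
Definition shrink (U : set Y) (k : nat) : set Y :=
  [set y | forall z, ~ U z -> k.+1%:R^-1 <= dist y z].

Lemma closed_shrink U k : closed (shrink U k).
Proof.
rewrite -openC; apply/open_distP => x /= /existsNP[z /not_implyP[Uz]].
move/negP; rewrite -ltNge => xz.
exists (k.+1%:R^-1 - dist x z); first by rewrite subr_gt0.
move=> y /= xy; apply/existsNP; exists z; apply/not_implyP; split => //.
apply/negP; rewrite -ltNge.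
have := dist_triangle y x z; rewrite (distC y x) => /le_lt_trans; apply.
by rewrite -ltrBrDr.
Qed.

Lemma shrink_sub U k : shrink U k `<=` U.
Proof.
move=> y Uy; apply: contrapT => /Uy; rewrite distxx; apply/negP.
by rewrite -ltNge invr_gt0.
Qed.

Lemma open_shrink U y : open U -> U y ->
  exists k, forall z, dist y z < k.+1%:R^-1 -> shrink U k z.
Proof.
move=> /open_distP oU /oU[e e0 eU].
(* With [2/(k+1) < e], one radius is spent moving from [y] to [z], the other on the distance from
   [z] to the complement. *)
pose k := Num.truncn (2 / e).
have ke : 2 * k.+1%:R^-1 < e.
  have : 2 / e < k.+1%:R by rewrite truncnS_gt.
  by rewrite ltr_pdivrMr// mulrC -ltr_pdivrMr// mulrC.
exists k => z yz z' Uz'; rewrite leNgt; apply/negP => zz'.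
apply: Uz'; apply: eU => /=.
apply: le_lt_trans (dist_triangle y z z') _; apply: lt_trans ke.
by rewrite mulrDl !mul1r ltrD.
Qed.

Lemma open_bigcup_shrink U : open U -> U = \bigcup_k shrink U k.
Proof.
move=> oU; apply/seteqP; split=> [y Uy|y [k _]]; last exact: shrink_sub.
have [k kU] := open_shrink oU Uy; exists k => //; apply: kU.
by rewrite distxx invr_gt0.
Qed.

Lemma measurable_open (U : set Y) : open U -> measurable (U : set (borel Y)).
Proof. by move=> oU; exact: sub_sigma_algebra. Qed.

Lemma measurable_closed (F : set Y) : closed F -> measurable (F : set (borel Y)).
Proof.
move=> cF; rewrite -[F]setCK; apply: measurableC.
by apply: measurable_open; exact: closed_openC.
Qed.

(** The limit lies in an open [U] exactly when, for some [k], the sequence is eventually in the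
    closed set [shrink U k]; this expresses the preimage by countable operations. *)
Lemma measurable_limit d (T : measurableType d) (s : nat -> T -> borel Y)
    (l : T -> borel Y) :
  (forall n, measurable_fun [set: T] (s n)) ->
  (forall x, (s ^~ x : nat -> Y) @ \oo --> (l x : Y)) ->
  measurable_fun [set: T] l.
Proof.
move=> ms sl; apply: (measurability (@open Y : set (set (borel Y)))) => //.
move=> _ [U oU <-]; rewrite setTI.
have -> : l @^-1` U = \bigcup_k \bigcup_N \bigcap_(n in [set n | (N <= n)%N])
    (s n @^-1` (shrink U k)).
  apply/seteqP; split=> x /=.
    move=> /(open_shrink oU)[k kU].
    have [N Ns] := (cvg_distP _ _).1 (sl x) k.+1%:R^-1 (ltac:(by rewrite invr_gt0)).
    by exists k => //; exists N => // n /= Nn; apply: kU; exact: Ns.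
  move=> [k _ [N _ Nx]]; apply: (@shrink_sub _ k).
  apply: (closed_cvg (shrink U k)) (sl x); first exact: closed_shrink.
  by exists N => // n /= Nn; exact: Nx.
apply: bigcupT_measurable => k; apply: bigcupT_measurable => N.
apply: bigcap_measurable; first by exists N => /=.
move=> n _; rewrite -[X in measurable X]setTI; apply: ms => //.
by apply: measurable_closed; exact: closed_shrink.
Qed.

(** * Inner approximation by sets with closed sections *)

Section inner_approximation.
Context d (T : measurableType d).
Variable nu : {finite_measure set (T * borel Y)%type -> \bar R}.

Definition closed_sections (C : set (T * borel Y)%type) : Prop :=
  forall x, closed (pair x @^-1` C : set Y).

Definition inner_approx (G : set (T * borel Y)%type) : Prop := forall e : R, 0 < e ->
  exists C, [/\ measurable C, closed_sections C, C `<=` G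
    & (nu (G `\` C) <= e%:E)%E].

Lemma inner_approx_closed C : measurable C -> closed_sections C ->
  inner_approx C.
Proof.
by move=> mC cC e e0; exists C; split => //; rewrite setDv measure0 lee_fin ltW.
Qed.

Let approx_seq (G : nat -> set (T * borel Y)%type) (e : R) : 0 < e ->
  (forall n, inner_approx (G n)) -> exists C : nat -> set (T * borel Y)%type,
  [/\ forall n, measurable (C n), forall n, closed_sections (C n),
    forall n, C n `<=` G n
    & forall n, (nu (G n `\` C n) <= (e / (2 ^ n.+1)%:R)%:E)%E].
Proof.
move=> e0 aG.
have /choice[C HC] n : exists C, [/\ measurable C, closed_sections C, C `<=` G n
    & (nu (G n `\` C) <= (e / (2 ^ n.+1)%:R)%:E)%E].
  by apply: aG; rewrite divr_gt0// ltr0n expn_gt0.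
by exists C; split => n; case: (HC n).
Qed.

Let sum_le (F : nat -> set (T * borel Y)%type) (e : R) : 0 < e ->
  (forall n, measurable (F n)) ->
  (forall n, (nu (F n) <= (e / (2 ^ n.+1)%:R)%:E)%E) ->
  (nu (\bigcup_n F n) <= e%:E)%E.
Proof.
move=> e0 mF Fe.
apply: (@le_trans _ _ (\sum_(0 <= n <oo) nu (F n))%E).
  apply: measure_sigma_subadditive => //; exact: bigcupT_measurable.
apply: (@le_trans _ _ (\sum_(0 <= n <oo) (0 + (e / (2 ^ n.+1)%:R)%:E))%E).
  by apply: lee_nneseries => // n _; rewrite add0e.
apply: (le_trans (epsilon_trick _ _ (ltW e0))) => //.
by rewrite eseries0// add0e.
Qed.

Lemma inner_approx_bigcap (G : nat -> set (T * borel Y)%type) :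
  (forall n, measurable (G n)) -> (forall n, inner_approx (G n)) ->
  inner_approx (\bigcap_n G n).
Proof.
move=> mG aG e e0; have [C [mC cC CG nuC]] := approx_seq e0 aG.
exists (\bigcap_n C n); split.
- exact: bigcapT_measurable.
- move=> x; rewrite preimage_bigcap.
  by apply: closed_bigI => n _; exact: cC.
- exact: subset_bigcap.
- apply: le_trans (sum_le e0 _ nuC); last by move=> n; exact: measurableD.
  apply: le_measure; rewrite ?inE.
  + by apply: measurableD; exact: bigcapT_measurable.
  + by apply: bigcupT_measurable => n; exact: measurableD.
  + move=> z [Gz]; rewrite /bigcap /= => /existsNP[n /not_implyP[_ Cz]].
    by exists n => //; split => //; exact: Gz.
Qed.

(** A countable union of closed sections need not be closed, so the union is cut after finitely many
    terms. Half of [e] pays for the approximations, the other half for the tail, by continuity from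
    above of the finite measure. *)
Lemma inner_approx_bigcup (G : nat -> set (T * borel Y)%type) :
  (forall n, measurable (G n)) -> (forall n, inner_approx (G n)) ->
  inner_approx (\bigcup_n G n).
Proof.
move=> mG aG e e0; have e2 : 0 < e / 2 by rewrite divr_gt0.
have [C [mC cC CG nuC]] := approx_seq e2 aG.
(* [D n] is the part of the union missed by the first [n] approximants. *)
pose D n := \bigcup_n G n `\` \big[setU/set0]_(i < n) C i.
have mU : measurable (\bigcup_n G n) by exact: bigcupT_measurable.
have mD n : measurable (D n).
  by apply: measurableD => //; exact: bigsetU_measurable.
have capD : \bigcap_n D n = \bigcup_n G n `\` \bigcup_n C n.
  apply/seteqP; split=> z.
    move=> Dz; split; first by have [] := Dz 0%N I.
    move=> [n _ Cnz]; have [_] := Dz n.+1 I; apply.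
    by rewrite big_ord_recr /=; right.
  move=> [Gz Cz] n _; split => //; rewrite -bigcup_mkord => -[i _ Ciz].
  by apply: Cz; exists i.
have nuD : (nu (\bigcap_n D n) <= (e / 2)%:E)%E.
  rewrite capD; apply: le_trans (sum_le e2 _ nuC); last first.
    by move=> n; exact: measurableD.
  apply: le_measure; rewrite ?inE.
  + by apply: measurableD => //; exact: bigcupT_measurable.
  + by apply: bigcupT_measurable => n; exact: measurableD.
  + by move=> z [[n _ Gz] Cz]; exists n => //; split => // ?; apply: Cz; exists n.
have : nu \o D @ \oo --> nu (\bigcap_n D n).
  apply: nonincreasing_cvg_mu => //.
  - by rewrite -ge0_fin_numE// fin_num_measure.
  - exact: bigcapT_measurable.
  - move=> m n mn; apply/subsetPset => z [Gz Cz]; split => // Cmz; apply: Cz.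
    by apply: (subset_bigsetU mn).
have nuDe : (nu (\bigcap_n D n) < e%:E)%E.
  by apply: le_lt_trans nuD _; rewrite lte_fin; lra.
move=> /(_ _ (open_ereal_lt' nuDe))[N _ /(_ N (leqnn N)) /= ND].
exists (\big[setU/set0]_(i < N) C i); split.
- exact: bigsetU_measurable.
- move=> x; rewrite -bigcup_mkord preimage_bigcup bigcup_mkord.
  by apply: closed_bigsetU => i _; exact: cC.
- rewrite -bigcup_mkord => z [i _ Ciz]; exists i => //; exact: CG.
- exact: ltW.
Qed.

(** Approximability is not stable under complement, but the sets approximable together with their
    complements form a sigma-algebra. *)
Lemma measurable_inner_approx G : measurable G -> inner_approx G.
Proof.
move=> mG.
suff : [set G | [/\ measurable G, inner_approx G & inner_approx (~` G)]] G.
  by case.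
move: G mG; apply: smallest_sub.
  split=> /=.
  - split => //.
      by apply: inner_approx_closed => // x; exact: closed0.
    by rewrite setC0; apply: inner_approx_closed => // x; exact: closedT.
  - by move=> G [mG aG aCG]; rewrite setTD setCK; split => //; exact: measurableC.
  - move=> F HF; split.
    + by apply: bigcupT_measurable => n; case: (HF n).
    + by apply: inner_approx_bigcup => n; case: (HF n).
    + rewrite setC_bigcup; apply: inner_approx_bigcap => n; case: (HF n) => //.
      by move=> mFn _ _; exact: measurableC.
(* Generators are cylinders over one factor. Over [T] the sections are empty or full; over [Y] a
   second induction reduces to open sets, which are countable unions of closed sets. *)
move=> _ [[E mE <-]|[B mB <-]]; rewrite setTI.
  have aE (S : set T) : measurable S -> inner_approx (fst @^-1` S).
    move=> mS; apply: inner_approx_closed.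
      by rewrite -[X in measurable X]setTI; exact: measurable_fst.
    move=> x; have [Sx|Sx] := pselect (S x).
      rewrite (_ : _ @^-1` _ = setT); first exact: closedT.
      by apply/seteqP; split=> y _ //; exact: Sx.
    rewrite (_ : _ @^-1` _ = set0); first exact: closed0.
    by apply/seteqP; split=> y // yS; apply: Sx; exact: yS.
  split; [|exact: aE|rewrite preimage_setC; apply: aE; exact: measurableC].
  by rewrite -[X in measurable X]setTI; exact: measurable_fst.
have mpre (S : set (borel Y)) : measurable S ->
    measurable (snd @^-1` S : set (T * borel Y)%type).
  by move=> mS; rewrite -[X in measurable X]setTI; exact: measurable_snd.
have aF (F : set Y) : closed F -> inner_approx (snd @^-1` F).
  move=> cF; apply: inner_approx_closed => //.
  by apply: mpre; exact: measurable_closed.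
suff : [set B : set (borel Y) | [/\ measurable B,
    inner_approx (snd @^-1` B) & inner_approx (~` (snd @^-1` B))]] B.
  by move=> [mB' a1 a2]; split => //; exact: mpre.
move: B mB; apply: smallest_sub.
  split=> /=.
  - split => //; first by rewrite preimage_set0; exact: aF closed0.
    by rewrite preimage_setC setC0; exact: aF closedT.
  - move=> B [mB aB aCB]; rewrite setTD -preimage_setC setCK.
    by split => //; exact: measurableC.
  - move=> F HF; split.
    + by apply: bigcupT_measurable => n; case: (HF n).
    + rewrite preimage_bigcup; apply: inner_approx_bigcup => n;
        case: (HF n) => // mFn _ _; exact: mpre.
    + rewrite preimage_bigcup setC_bigcup.
      apply: inner_approx_bigcap => n; case: (HF n) => // mFn _ _.
      by rewrite preimage_setC; apply: mpre; exact: measurableC.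
move=> U oU; split; first exact: measurable_open.
- rewrite (open_bigcup_shrink oU) preimage_bigcup.
  apply: inner_approx_bigcup => k; last exact/aF/closed_shrink.
  by apply: mpre; apply: measurable_closed; exact: closed_shrink.
- by rewrite preimage_setC; apply: aF; exact: open_closedC.
Qed.

End inner_approximation.

End distance.

(** * Least indices and their measurability *)

Lemma invS_lt (R : realType) (e : R) : 0 < e -> exists N, 
  forall n, (N <= n)%N -> n.+1%:R^-1 < e.
Proof.
move=> e0; exists (Num.truncn e^-1) => n Nn.
rewrite -[ltRHS]invrK ltf_pV2 ?posrE ?invr_gt0//.
by apply: (lt_le_trans (truncnS_gt _)); rewrite ler_nat ltnS.
Qed.

(** Total by convention: the value is [0] when no index satisfies [P], which is the second
    alternative in [first_index_eq]. *)
Definition first_index (P : nat -> Prop) : nat :=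
  if pselect (exists i, `[< P i >]) is left e then ex_minn e else 0%N.

Lemma first_indexP (P : nat -> Prop) : (exists i, P i) -> P (first_index P).
Proof.
move=> [i Pi]; rewrite /first_index; case: pselect => [e|[]].
  by case: ex_minnP => m /asboolP.
by exists i; exact/asboolP.
Qed.

Lemma first_index_eq (P : nat -> Prop) i : first_index P = i <->
  (P i /\ forall j, (j < i)%N -> ~ P j) \/ (i = 0%N /\ forall j, ~ P j).
Proof.
rewrite /first_index; case: pselect => [e|nP].
  case: ex_minnP => m /asboolP Pm Pmin; split=> [<-|].
    by left; split => // j jm /asboolP/Pmin; rewrite leqNgt jm.
  move=> [[Pi ilt]|[_ /(_ _ Pm)]//].
  apply/eqP; rewrite eqn_leq Pmin /=; last exact/asboolP.
  by rewrite leqNgt; apply/negP => /ilt.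
have nP' j : ~ P j by move=> Pj; apply: nP; exists j; exact/asboolP.
by split=> [<-|[[/nP']|[]]]//; right.
Qed.

Section measurable_index.
Context d (T : measurableType d).

Lemma measurable_first_index (P : nat -> T -> Prop) :
  (forall i, measurable [set x | P i x]) ->
  measurable_fun [set: T] (fun x => first_index (P ^~ x)).
Proof.
move=> mP _ S _; rewrite setTI.
have mnP i : measurable [set x | ~ P i x] by apply: (measurableC (mP i)).
have -> : (fun x => first_index (P ^~ x)) @^-1` S = \bigcup_(i in S)
    (([set x | P i x] `&` \bigcap_(j in `I_i) [set x | ~ P j x]) `|`
     (if i == 0%N then \bigcap_j [set x | ~ P j x] else set0)).
  apply/seteqP; split=> x /=.
    move=> Si; exists (first_index (P ^~ x)) => //.
    have [[? ?]|[e Pn]] := (first_index_eq _ _).1 (erefl (first_index (P ^~ x))).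
      by left.
    by right; rewrite e eqxx => j _; exact: Pn.
  move=> [i Si iP]; rewrite (_ : first_index _ = i)//; apply/first_index_eq.
  case: iP => [[? ?]|]; first by left.
  by case: eqP => // -> Pj; right; split=> // j; exact: Pj.
apply: bigcup_measurable => i _; apply: measurableU.
  apply: measurableI => //; apply: bigcap_measurableType => j _; exact: mnP.
by case: ifP => // _; exact: bigcapT_measurable.
Qed.

Variable idx : T -> nat.
Hypothesis midx : measurable_fun [set: T] idx.

Lemma measurable_at_index (Q : nat -> T -> Prop) :
  (forall i, measurable [set x | Q i x]) -> measurable [set x | Q (idx x) x].
Proof.
move=> mQ; have -> : [set x | Q (idx x) x] =
    \bigcup_i (idx @^-1` [set i] `&` [set x | Q i x]).
  apply/seteqP; split=> x /=; first by exists (idx x).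
  by move=> [i _ [<-]].
apply: bigcupT_measurable => i; apply: measurableI => //.
by rewrite -[X in measurable X]setTI; exact: midx.
Qed.

Lemma measurable_fun_at_index d' (U : measurableType d') (g : nat -> T -> U) :
  (forall i, measurable_fun [set: T] (g i)) ->
  measurable_fun [set: T] (fun x => g (idx x) x).
Proof.
move=> mg _ B mB; rewrite setTI.
apply: (measurable_at_index (Q := fun i x => B (g i x))) => i.
by rewrite -[X in measurable X]setTI; exact: mg.
Qed.

End measurable_index.

(** * Selection by nested balls of positive measure *)

Section selection.
Context (R : realType) (Y : ptopologicalType) (dist : Y -> Y -> R).
Hypotheses (dist0 : forall x y, dist x y = 0 <-> x = y)
  (distC : forall x y, dist x y = dist y x)
  (dist_triangle : forall x y z, dist x z <= dist x y + dist y z)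
  (nbhs_dist : forall x (U : set Y), nbhs x U <->
    exists2 e : R, 0 < e & [set y | dist x y < e] `<=` U)
  (dist_complete : forall s : nat -> Y,
    (forall e : R, 0 < e -> exists N : nat, forall m n : nat,
       (N <= m)%N -> (N <= n)%N -> dist (s m) (s n) < e) ->
    exists l : Y, s @ \oo --> l).
Variable s : nat -> Y.
Hypothesis s_dense : forall y (e : R), 0 < e -> exists i, dist (s i) y <= e.

Context d (T : measurableType d).
Variable K : T -> probability (borel Y) R.
Hypothesis mK : measurable_fun [set: T] (K : T -> pprobability (borel Y) R).

Let cball n i : set (borel Y) := [set y | dist (s i) y <= n.+1%:R^-1].

Let measurable_cball n i : measurable (cball n i).
Proof. by apply: measurable_closed; exact: closed_dist_ball. Qed.

Section nested_sets.
Variable C : set (T * borel Y)%type.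
Hypotheses (mC : measurable C) (cC : closed_sections C).

Let idx_in (D : set (T * borel Y)%type) n x :=
  first_index (fun i => 0 < K x (pair x @^-1` D `&` cball n i))%E.

(** Stage [n] cuts the current set, above each [x], by the first closed ball of radius [1/(n+1)]
    around a dense point that leaves positive [K x]-measure. Taking the first index keeps the choice
    measurable in [x]. *)
Fixpoint nest n : set (T * borel Y)%type :=
  if n is n'.+1 then
    nest n' `&` [set z | cball n' (idx_in (nest n') n' z.1) z.2]
  else C.

Let idx n x := idx_in (nest n) n x.

Let measurable_idx_in D n : measurable D -> measurable_fun [set: T] (idx_in D n).
Proof.
move=> mD; apply: measurable_first_index => i.
have mDi : measurable (D `&` snd @^-1` (cball n i)).
  apply: measurableI => //; rewrite -[X in measurable X]setTI.
  exact: measurable_snd.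
rewrite -[X in measurable X]setTI; apply: measurable_lte => //.
rewrite (_ : (fun x => _) =
  (fun x => K x (xsection (D `&` snd @^-1` (cball n i)) x))).
  exact: measurable_kernel_section.
by apply/funext => x; rewrite xsectionE.
Qed.

Lemma measurable_nest n : measurable (nest n).
Proof.
elim: n => //= n mn; apply: measurableI => //.
apply: (@measurable_at_index _ _ (idx n \o fst) _
  (fun i (z : (T * borel Y)%type) => cball n i z.2)).
  by apply: measurableT_comp => //; exact: measurable_idx_in.
by move=> i; rewrite -[X in measurable X]setTI; exact: measurable_snd.
Qed.

Let measurable_slice (D : set (T * borel Y)%type) x : measurable D ->
  measurable (pair x @^-1` D : set (borel Y)).
Proof. by move=> mD; rewrite -xsectionE; exact: measurable_xsection. Qed.

Let Kpos x := (0 < K x (pair x @^-1` C))%E.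

(** The balls of each radius cover [Y], so by countable subadditivity one of them meets a set of
    positive measure in positive measure. *)
Let nest_pos x n : Kpos x -> (0 < K x (pair x @^-1` (nest n)))%E.
Proof.
move=> Cx; elim: n => // n IH /=.
have := @first_indexP (fun i => 0 < K x (pair x @^-1` (nest n) `&` cball n i))%E.
apply; apply: contrapT => /forallNP H0; move: IH; apply/negP; rewrite -leNgt.
have -> : pair x @^-1` nest n = \bigcup_i (pair x @^-1` nest n `&` cball n i).
  apply/seteqP; split=> [y ny|y [i _ []]//].
  have [|i iy] := s_dense y (e := n.+1%:R^-1); first by rewrite invr_gt0.
  by exists i.
have mI i : measurable (pair x @^-1` nest n `&` cball n i : set (borel Y)).
  by apply: measurableI => //; apply: measurable_slice; exact: measurable_nest.
apply: (le_trans (measure_sigma_subadditive _ mI _ (subset_refl _))); [|by []|].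
  exact: bigcupT_measurable.
rewrite eseries0// => i _ _; apply/eqP; rewrite eq_le measure_ge0 andbT leNgt.
exact/negP/H0.
Qed.

Let center n x : Y := s (idx n x).

Let nest_decr m n : (m <= n)%N -> nest n `<=` nest m.
Proof.
elim: n => [|n IH]; first by rewrite leqn0 => /eqP ->.
rewrite leq_eqVlt ltnS => /orP[/eqP ->//|/IH nm] z /= [nz _]; exact: nm.
Qed.

Let nest_ball m n x y : (m < n)%N -> nest n (x, y) ->
  dist (center m x) y <= m.+1%:R^-1.
Proof. by move=> mn /(nest_decr mn)[]. Qed.

Let nest_point n x : Kpos x -> exists y, nest n (x, y).
Proof.
move=> /(nest_pos n); apply: contraPP => /forallNP H0.
rewrite (_ : pair x @^-1` nest n = set0) ?measure0 ?ltxx//.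
by apply/seteqP; split=> // y; exact: H0.
Qed.

Let limit_ex x : Kpos x -> exists l : Y, (center ^~ x) @ \oo --> l.
Proof.
move=> Cx; apply: dist_complete => e e0.
have [|N Ns] := invS_lt (e := e / 2); first by rewrite divr_gt0.
exists N => m n Nm Nn.
(* A point of the set at stage [maxn m n + 1] lies in the balls chosen at stages [m] and [n], so the
   two centres are close. *)
have [y ny] := nest_point (maxn m n).+1 Cx.
have my := @nest_ball m (maxn m n).+1 x y (leq_maxl _ _) ny.
have ny' := @nest_ball n (maxn m n).+1 x y (leq_maxr _ _) ny.
have := dist_triangle (center m x) y (center n x); rewrite (distC y).
have := Ns _ Nm; have := Ns _ Nn => {ny}.
move: my ny'; set a := _^-1; set b := _^-1 => *; lra.
Qed.

Definition nest_limit (x : T) : borel Y :=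
  if pselect (Kpos x /\ exists l : Y, (center ^~ x) @ \oo --> l) is left xl
  then projT1 (cid xl.2) else point.

Let nest_limitP x : Kpos x -> (center ^~ x) @ \oo --> (nest_limit x : Y).
Proof.
move=> Cx; rewrite /nest_limit; case: pselect => [?|[]]; first by case: cid.
by split => //; exact: limit_ex.
Qed.

Lemma measurable_Kpos : measurable [set x | Kpos x].
Proof.
rewrite -[X in measurable X]setTI; apply: measurable_lte => //.
under eq_fun do rewrite -xsectionE.
exact: measurable_kernel_section.
Qed.

Lemma measurable_nest_limit : measurable_fun [set: T] nest_limit.
Proof.
(* Off [Kpos] the centres are replaced by the default value of [nest_limit], so that convergence
   holds everywhere. *)
apply: (measurable_limit dist0 distC dist_triangle nbhs_dist
  (s := fun n x => if `[< Kpos x >] then center n x else point)) => [n|x].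
  apply: measurable_fun_ifT => //.
    apply: (measurable_fun_bool true).
    rewrite setTI (_ : _ @^-1` _ = [set x | Kpos x]); first exact: measurable_Kpos.
    by apply/seteqP; split=> x /= /asboolP.
  have midx : measurable_fun [set: T] (idx n).
    by apply: measurable_idx_in; exact: measurable_nest.
  by apply: (measurable_fun_at_index midx (g := fun i _ => s i : borel Y)).
case: asboolP => [Cx|Cx]; first exact: nest_limitP.
rewrite /nest_limit; case: pselect => [[]//|_]; exact: cvg_cst.
Qed.

Let near_limit x (e : R) : Kpos x -> 0 < e -> exists n, forall y,
  nest n (x, y) -> dist (nest_limit x) y < e.
Proof.
move=> Cx e0; have e2 : 0 < e / 2 by rewrite divr_gt0.
have [N1 Ns] := invS_lt e2.
have [N2 Nl] := (cvg_distP nbhs_dist _ _).1 (nest_limitP Cx) _ e2.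
exists (maxn N1 N2).+1 => y /(nest_ball (leqnn _)) ny.
have := Nl _ (leq_maxr N1 N2); have := Ns _ (leq_maxl N1 N2).
have := dist_triangle (nest_limit x) (center (maxn N1 N2) x) y.
move: ny; set a := _^-1 => *; lra.
Qed.

(** Otherwise some ball around the limit would miss the closed section, whereas a late nested set is
    nonempty and lies in both. *)
Lemma nest_limit_mem x : Kpos x -> C (x, nest_limit x).
Proof.
move=> Cx; apply: contrapT => nC.
have /(open_distP nbhs_dist) oC : open (~` (pair x @^-1` C : set Y)).
  exact/closed_openC/cC.
have [e e0 eC] := oC (nest_limit x) nC.
have [n nl] := near_limit Cx e0; have [y ny] := nest_point n Cx.
by apply: (eC y (nl _ ny)); apply: (nest_decr (leq0n n)).
Qed.

(** Every neighbourhood of the limit contains a nested set, which has positive measure. *)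
Lemma nest_limit_supp x : Kpos x -> supp (K x) (nest_limit x).
Proof.
move=> Cx U oU Ux; have [e e0 eU] := (open_distP nbhs_dist _).1 oU _ Ux.
have [n nl] := near_limit Cx e0; apply: (lt_le_trans (nest_pos n Cx)).
apply: le_measure; rewrite ?inE.
- by apply: measurable_slice; exact: measurable_nest.
- exact: measurable_open.
- by move=> y /nl; exact: eU.
Qed.

End nested_sets.

Variable mu : probability T R.

(** Sets [C n] with closed sections fill [G] up to [1/(n+1)] in joint measure. The point is taken in
    the first [C n] whose section at [x] has positive measure. *)
Lemma dist_large_section_selection (G : set (T * borel Y)%type) : measurable G ->
  exists (B : set T) (y : T -> borel Y), [/\ measurable B,
    measurable_fun [set: T] y,
    forall x, B x -> G (x, y x) /\ supp (K x) (y x)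
    & {ae mu, forall x, (0 < K x (xsection G x))%E -> B x}].
Proof.
move=> mG.
have aG := measurable_inner_approx dist0 distC dist_triangle nbhs_dist
  (joint_law mu mK) mG.
have /choice[C HC] n : exists C, [/\ measurable C, closed_sections C, C `<=` G
    & (joint_law mu mK (G `\` C) <= (n.+1%:R^-1)%:E)%E].
  by apply: aG; rewrite invr_gt0.
pose pos n x := (0 < K x (pair x @^-1` (C n)))%E.
have mpos n : measurable [set x | pos n x].
  by apply: measurable_Kpos; case: (HC n).
pose idx x := first_index (pos ^~ x).
exists (\bigcup_n [set x | pos n x]), (fun x => nest_limit (C (idx x)) x); split.
- exact: bigcupT_measurable.
- apply: (measurable_fun_at_index (measurable_first_index mpos)
    (g := fun n => nest_limit (C n))) => n.
  by apply: measurable_nest_limit; case: (HC n).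
- move=> x [n _ nx].
  have px : pos (idx x) x.
    exact: (@first_indexP (pos ^~ x) (ex_intro _ n nx)).
  have [mC cC CG _] := HC (idx x).
  by split; [apply: CG; exact: nest_limit_mem|exact: nest_limit_supp].
(* The part of [G] outside all [C n] is null for the joint law, so almost all its sections are null;
   a section of [G] of positive measure then forces positive measure in some [C n]. *)
- have mU : measurable (G `\` \bigcup_n C n).
    apply: measurableD => //; apply: bigcupT_measurable => n.
    by case: (HC n).
  have nu0 : (joint_law mu mK (G `\` \bigcup_n C n) = 0)%E.
    apply/eqP; rewrite eq_le measure_ge0 andbT; apply/lee_addgt0Pr => e e0.
    rewrite add0e; have [n ne] : exists n, n.+1%:R^-1 < e.
      have [N Ns] := invS_lt e0; exists N; exact: Ns.
    have [mC cC CG nuC] := HC n.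
    apply: (@le_trans _ _ (joint_law mu mK (G `\` C n))).
      apply: le_measure; rewrite ?inE //; first exact: measurableD.
      by apply: setDS; exact: bigcup_sup.
    by apply: (le_trans nuC); rewrite lee_fin ltW.
  move: nu0; rewrite joint_lawE// => nu0.
  have : {ae mu, forall x, (K x (xsection (G `\` \bigcup_n C n) x) = 0)%E}.
    have := ae_eq_integral_abs mu measurableT (measurable_kernel_section mK mU).
    move=> [+ _]; under eq_integral do rewrite gee0_abs//.
    by move=> /(_ nu0); apply: filterS => x /(_ I).
  apply: filterS => x K0 Gx; apply: contrapT => nx.
  move: Gx; apply/negP; rewrite -leNgt.
  have mCn n : measurable (pair x @^-1` C n : set (borel Y)).
    by rewrite -xsectionE; apply: measurable_xsection; case: (HC n).
  have mxU : measurable (xsection (G `\` \bigcup_n C n) x).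
    exact: measurable_xsection.
  apply: (@le_trans _ _ (K x (xsection (G `\` \bigcup_n C n) x `|`
      \bigcup_n (pair x @^-1` C n)))%E).
    apply: le_measure; rewrite ?inE.
    + exact: measurable_xsection.
    + by apply: measurableU => //; exact: bigcupT_measurable.
    + move=> y; rewrite !xsectionE /= => Gy.
      have [Cy|Cy] := pselect ((\bigcup_n C n) (x, y)); last by left.
      by right; case: Cy => n _ ?; exists n.
  apply: (@le_trans _ _ (K x (xsection (G `\` \bigcup_n C n) x) +
      K x (\bigcup_n (pair x @^-1` C n)))%E).
    by apply: measureU2 => //; exact: bigcupT_measurable.
  rewrite K0 add0e.
  apply: (le_trans (measure_sigma_subadditive _ mCn _ (subset_refl _))); [|by []|].
    exact: bigcupT_measurable.
  rewrite eseries0// => n _ _; apply/eqP; rewrite eq_le measure_ge0 andbT leNgt.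
  by apply/negP => ?; apply: nx; exists n.
Qed.

End selection.

(* Sections of positive measure admit a measurable selection, which can moreover
   be taken in the supports: approximate from inside by sets with closed
   sections, where nested balls of positive measure shrink to a point. *)
Lemma large_section_selection (R : realType) (Y : ptopologicalType)
    (polY : polish R Y) d (T : measurableType d)
    (K : T -> probability (borel Y) R)
    (mK : measurable_fun [set: T] (K : T -> pprobability (borel Y) R))
    (mu : probability T R) (G : set (T * borel Y)%type) : measurable G ->
  exists (B : set T) (y : T -> borel Y), [/\ measurable B,
    measurable_fun [set: T] y,
    forall x, B x -> G (x, y x) /\ supp (K x) (y x)
    & {ae mu, forall x, (0 < K x (xsection G x))%E -> B x}].
Proof.
move=> mG; case: polY => -[S cS dS] [dist [d0 dC dT dN dX]].
have [i iS] : exists i : Y -> nat, {in S &, injective i}.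
  by have /countable_injP := cS.
(* The injection [i] of the countable dense set is inverted to a sequence; indices outside its range
   receive [point]. *)
pose s n : Y := xget point [set y | S y /\ i y = n].
apply: (dist_large_section_selection d0 dC dT dN dX (s := s) _ mK mu mG).
move=> y e e0.
have [z [Sz yz]] : (S `&` [set z | dist y z < e]) !=set0.
  have oB : open [set z | dist y z < e].
    apply/(open_distP dN) => x /= yx; exists (e - dist y x).
      by rewrite subr_gt0.
    move=> z /= xz; apply: le_lt_trans (dT y x z) _.
    by rewrite -ltrBrDl.
  have [|z [? ?]] := dS _ _ oB; last by exists z.
  by exists y => /=; rewrite (distxx d0).
exists (i z); rewrite dC.
have [Sx ix] : S (s (i z)) /\ i (s (i z)) = i z.
  by rewrite /s; case: xgetP => [x ->//|/(_ z)[]].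
rewrite (iS (s (i z)) z) ?inE//; exact: ltW.
Qed.

(** * Contaminated arm laws *)

Lemma measurable_univ_measurable (R : realType) d d' (T : measurableType d)
    (U : measurableType d') (g : T -> U) :
  measurable_fun [set: T] g -> univ_measurable_fun R g.
Proof.
move=> mg B mB mu; have mgB : measurable (g @^-1` B).
  by rewrite -[X in measurable X]setTI; exact: mg.
by exists (g @^-1` B), (g @^-1` B); split => //; rewrite setDv measure0.
Qed.

(** If [g] were almost surely nonpositive with zero mean, it would vanish almost surely. *)
Lemma zero_mean_gt0 d (T : measurableType d) (R : realType)
    (m : probability T R) (g : T -> R) : m.-integrable [set: T] (EFin \o g) ->
  (\int[m]_t (g t)%:E = 0)%E -> (0 < m [set t | (g t < 0)%R])%E ->
  (0 < m [set t | (0 < g t)%R])%E.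
Proof.
move=> ig g0; apply: contraTT; rewrite -!leNgt => gpos.
have mg : measurable_fun [set: T] g by apply/measurable_EFinP; exact: measurable_int ig.
have mpos : measurable [set t | 0 < g t].
  by rewrite -[X in measurable X]setTI; exact: measurable_fun_ltr.
have mneg : measurable [set t | g t < 0].
  by rewrite -[X in measurable X]setTI; exact: measurable_fun_ltr.
have gle0 : {ae m, forall t, g t <= 0}.
  exists [set t | 0 < g t]; split=> //; first by apply/eqP; rewrite -measure_le0.
  by move=> t /= /negP; rewrite -ltNge.
have absg : (\int[m]_t `|(EFin \o g) t| = 0)%E.
  transitivity (\int[m]_t - (g t)%:E)%E.
    apply: ae_eq_integral => //.
    - exact/measurableT_comp/(measurable_int _ ig).
    - exact/measurableT_comp/(measurable_int _ ig).
    - by apply: filterS gle0 => t gt _ /=; rewrite ler0_norm// EFinN.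
  by rewrite (integralN (integrable_add_def measurableT ig)) g0 oppe0.
have [/(_ absg)[N [mN N0 NE]] _] :=
  ae_eq_integral_abs m measurableT (measurable_int _ ig).
rewrite -N0 le_measure ?inE// => t /= gt; apply: NE => /= /(_ I) [gt0].
by rewrite gt0 ltxx in gt.
Qed.

(** Written as [x] times a power of the nonnegative [x ^+ 2]; at [0] both sides are [0]. *)
Lemma measurable_inverse (R : realType) : measurable_fun [set: R] (@GRing.inv R).
Proof.
have -> : @GRing.inv R = fun x : R => x * powR (x ^+ 2) (- 1).
  apply/funext => x; rewrite powR_inv1 ?sqr_ge0//.
  have [->|x0] := eqVneq x 0; first by rewrite invr0 mul0r.
  by rewrite expr2 invfM mulrA divff// mul1r.
apply: measurable_funM => //.
by apply: (measurableT_comp (measurable_powR _)); exact: measurable_funX.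
Qed.

Lemma measurable_coordinate (R : realType) (A : Type) d (T : measurableType d)
    (g : T -> A -> R) a : measurable_fun [set: T] (g : T -> vec R A) ->
  measurable_fun [set: T] (fun x => g x a).
Proof.
move=> mg _ B mB; rewrite setTI.
have -> : (fun x => g x a) @^-1` B = g @^-1` [set v : vec R A | B (v a)] by [].
rewrite -[X in measurable X]setTI; apply: mg => //.
by apply: sub_sigma_algebra; exists a, B.
Qed.

Section contamination.
Context (R : realType) (A : pfinType) (X Wt Waux : ptopologicalType).
Variables (M : max_arm_model R A X Wt) (D : perturbation_data R A X Wt).
Hypotheses (structM : max_arm_structure M) (standM : standing_conditions M)
  (pertM : perturbation_conditions M D).
Variable f : borel X * obs A Wt * (vec R A * vec R A) * discrete {set A}
         * borel Waux -> R.
Hypothesis fFB : F_B M f.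
Variable w : X -> Waux.
Hypothesis mw : measurable_fun [set: borel X] (w : borel X -> borel Waux).
Variable P : law R A X Wt.
Hypothesis MP : laws M P.
Hypothesis polWt : polish R Wt.
Local Notation obs := (obs A Wt).

Let F (a : A) (x : X) (t : Wt) : R := at_law M f P w x (a, t).

Let PX : probability (borel X) R := marginal P.

Lemma measurable_arm_at_law a : measurable_fun [set: borel X * borel Wt]
  (fun z : borel X * borel Wt => F a z.1 z.2).
Proof.
apply/measurable_EFinP.
have mg : measurable_fun [set: borel X * borel Wt]
    (fun z : borel X * borel Wt => (z.1, ((a : discrete A), z.2)) : borel X * obs).
  apply: measurable_fun_pair; first exact: measurable_fst.
  by apply: measurable_fun_pair; [exact: measurable_cst|exact: measurable_snd].
exact: (measurableT_comp (measurable_at_law fFB mw MP) mg).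
Qed.

Lemma measurable_arm_law a : measurable_fun [set: borel X]
  (arm_law M P a : borel X -> pprobability (borel Wt) R).
Proof. by case: structM => _ /(_ _ MP)[]. Qed.

Let dP x : arm_decomposition (cond M P x) (propensity M P x)
  (fun a => arm_law M P a x).
Proof. by case: structM => _ /(_ _ MP)[_ _ _ dP _] _ _ _. Qed.

Let p0 x a : 0 < propensity M P x a.
Proof. by case: structM => _ /(_ _ MP)[]. Qed.

Let hL x a : (arm_law M P a x).-integrable [set: borel Wt] (EFin \o score M a)
  /\ ('E_(arm_law M P a x)[score M a] = (uval M P x a)%:E)%E.
Proof. by case: structM => _ _ _ /(_ _ MP x a). Qed.

Let mh a : measurable_fun [set: borel Wt] (score M a).
Proof. by case: structM => -[_ _ +]. Qed.

Lemma ae_cond_identity : {ae PX, forall x,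
  (cond M P x).-integrable setT (fun o => (at_law M f P w x o)%:E) /\
  (\int[cond M P x]_o (at_law M f P w x o)%:E = (psi M x (uval M P x))%:E)%E}.
Proof. by apply: (pointwise_identity structM standM fFB mw MP MP); exact: aeW. Qed.

Lemma ae_arm_integrable : {ae PX, forall x, forall a,
  (arm_law M P a x).-integrable [set: borel Wt] (EFin \o F a x)}.
Proof.
apply: filterS ae_cond_identity => x [ix _] a.
have mx := measurable_at_law_section fFB mw MP x.
exact: (arm_integrable (p0 x) (dP x) mx a ix).
Qed.

Definition arm_mean (a : A) (x : X) : R :=
  fine (\int[arm_law M P a x]_t (F a x t)%:E)%E.

Lemma measurable_arm_mean a : measurable_fun [set: borel X]
  (arm_mean a : borel X -> R).
Proof.
apply: measurableT_comp => //.
apply: (measurable_kernel_integral (measurable_arm_law a)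
  (F := fun z => (F a z.1 z.2)%:E)).
by apply/measurable_EFinP; apply: measurable_arm_at_law.
Qed.

Lemma arm_meanE a x :
  (arm_law M P a x).-integrable [set: borel Wt] (EFin \o F a x) ->
  (\int[arm_law M P a x]_t (F a x t)%:E = (arm_mean a x)%:E)%E.
Proof. by move=> iF; rewrite fineK// (integrable_fin_num _ iF). Qed.

Lemma ae_arm_mean_sum : {ae PX, forall x,
  \sum_a propensity M P x a * arm_mean a x = psi M x (uval M P x)}.
Proof.
move: ae_cond_identity ae_arm_integrable; apply: filterS2 => x [ix Ex] iF.
have mx := measurable_at_law_section fFB mw MP x.
apply: EFin_inj; rewrite -Ex (integral_arm (p0 x) (dP x) mx)// -sumEFin.
by apply: eq_bigr => a _; rewrite EFinM arm_meanE.
Qed.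

(** The atoms have the baseline score mean as barycentre, so contaminating arm [a] by them keeps
    every nuisance and hence the conditional mean of [F]. Only the contribution of arm [a] has been
    altered. *)
Lemma two_point_identity a (B : set (borel X)) (y1 y2 : borel X -> borel Wt)
    (p : borel X -> R) : measurable B -> measurable_fun [set: borel X] y1 ->
  measurable_fun [set: borel X] y2 -> measurable_fun [set: borel X] p ->
  (forall x, B x -> [/\ 0 <= p x <= 1, supp (arm_law M P a x) (y1 x),
    supp (arm_law M P a x) (y2 x)
    & p x * score M a (y1 x) + (1 - p x) * score M a (y2 x) = uval M P x a]) ->
  {ae PX, forall x, B x ->
    p x * F a x (y1 x) + (1 - p x) * F a x (y2 x) = arm_mean a x}.
Proof.
move=> mB my1 my2 mp HB.
(* Clipping to the unit interval makes [convex_pair] available at every [x]; on [B] nothing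
   changes. *)
pose q x := Num.max 0 (Num.min 1 (p x)).
have mq : measurable_fun [set: borel X] q.
  by apply: measurable_maxr => //; exact: measurable_minr.
have q01 x : 0 <= q x <= 1 by rewrite /q le_max lexx /= ge_max ler01 ge_min lexx.
have qB x : B x -> q x = p x.
  by move=> /HB[/andP[? ?] _ _ _]; rewrite /q min_r// max_r.
have half01 : 0 <= (1 / 2 : R) <= 1 by apply/andP; split; lra.
pose nu x : probability (borel Wt) R := convex_pair (q01 x) (\d_(y1 x)) (\d_(y2 x)).
pose L x : probability (borel Wt) R := convex_pair half01 (arm_law M P a x) (nu x).
pose Ls x b := if b == a then L x else arm_law M P b x.
have sum1 x : (forall b, 0 <= propensity M P x b) /\ \sum_b propensity M P x b = 1.
  by split=> [b|]; [exact/ltW|exact: arm_decomposition_sum1 (dP x)].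
pose Q0 x : probability obs R := mixture_probability (at_arm (Ls x)) (sum1 x).
pose Q x := if `[< B x >] then Q0 x else cond M P x.
have dQ0 x : arm_decomposition (Q0 x) (propensity M P x) (Ls x).
  apply: arm_decompositionP => E mE.
  rewrite -[LHS]/(mixture (propensity M P x) (at_arm (Ls x)) E).
  by rewrite mixtureE//; exact: (sum1 x).1.
have mLs b : measurable_fun [set: borel X]
    ((fun x => Ls x b) : borel X -> pprobability (borel Wt) R).
  apply: measurable_pprobability => E mE; rewrite /Ls.
  case: eqP => _; last exact: measurable_pprobabilityE (measurable_arm_law b) mE.
  have mdirac y : measurable_fun [set: borel X] y ->
      measurable_fun [set: borel X] (fun x => \d_(y x) E : \bar R).
    by move=> my; exact: (measurable_kernel (kdirac my)).
  under eq_fun do rewrite /L /nu !convex_pairE.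
  apply: emeasurable_funD.
    apply: measurable_funeM; exact: measurable_pprobabilityE (measurable_arm_law a) mE.
  apply: measurable_funeM; apply: emeasurable_funD; apply: emeasurable_funM.
  - exact/measurable_EFinP.
  - exact: mdirac.
  - by apply/measurable_EFinP; exact: measurable_funB.
  - exact: mdirac.
have mQ : measurable_fun [set: borel X] (Q : borel X -> pprobability obs R).
  apply: measurable_fun_ifT => //.
  - apply: (measurable_fun_bool true).
    by rewrite setTI (_ : _ @^-1` _ = B)//; apply/seteqP; split=> x /= /asboolP.
  - apply: measurable_pprobability => E mE.
    rewrite (_ : (fun x => _) = (fun x => \sum_b
        (propensity M P x b)%:E * Ls x b (pair (b : discrete A) @^-1` E)))%E.
      apply: emeasurable_sum => b; apply: emeasurable_funM.
        apply/measurable_EFinP.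
        case: structM => _ /(_ _ MP)[_ mpi _ _ _] _ _ _.
        exact: measurable_coordinate mpi.
      apply: measurable_pprobabilityE; first exact: mLs.
      by rewrite -xsectionE; exact: measurable_xsection.
    apply/funext => x.
    rewrite -[LHS]/(mixture (propensity M P x) (at_arm (Ls x)) E).
    by rewrite mixtureE//; exact: (sum1 x).1.
  - by case: structM => _ /(_ _ MP)[[]].
have nuE x (g : Wt -> R) : measurable_fun [set: borel Wt] g ->
    (nu x).-integrable [set: borel Wt] (EFin \o g) /\
    (\int[nu x]_t (g t)%:E = (q x * g (y1 x) + (1 - q x) * g (y2 x))%:E)%E.
  move=> mg; split; first by apply: integrable_convex_pair; exact: integrable_dirac.
  rewrite integral_convex_pair; [|exact: integrable_dirac..].
  rewrite !integral_dirac//; [|exact/measurable_EFinP..].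
  by rewrite !diracT !mul1e.
have Lh x : B x -> (L x).-integrable [set: borel Wt] (EFin \o score M a) /\
    ('E_(L x)[score M a] = (uval M P x a)%:E)%E.
  move=> Bx; have [_ _ _ xE] := HB _ Bx; have [ih hE] := hL x a.
  have [inu nuh] := nuE x _ (mh a).
  split; first exact: integrable_convex_pair.
  move: hE; rewrite unlock integral_convex_pair// => ->.
  rewrite nuh (qB _ Bx) xE -!EFinM -EFinD; congr EFin; ring.
have contP := (pertM MP).
case: contP => /(_ a)[cont _ radm _] _ _.
have admP : {ae PX, forall x, adm M x (cond M P x)}.
  by case: standM => _ _ _ /(_ _ MP)[].
have admQ : {ae PX, forall x, adm M x (Q x)}.
  move: cont radm admP; apply: filterS3 => x contx radmx admx.
  rewrite /Q; case: asboolP => // Bx; have [_ s1 s2 xE] := HB _ Bx.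
  apply: radmx; exists (L x); last exact: dQ0.
  apply: (contx (1 / 2) (nu x)).
  - by apply/andP; split; lra.
  - exists [set y1 x; y2 x]; split.
    + exact: finite_set2.
    + by move=> _ [->|->].
    + have d1 y S : S y -> (\d_y : probability (borel Wt) R) S = 1%E.
        by move=> Sy; rewrite -[LHS]/(dirac y S) diracE mem_set.
      rewrite convex_pairE !d1; [|by right|by left].
      by rewrite !mule1 -EFinD; congr EFin; ring.
  - have [_] := nuE x _ (mh a); rewrite unlock => ->.
    by rewrite (qB _ Bx) xE.
  - move=> E mE; rewrite convex_pairE.
    by have -> : 1 - 1 / 2 = 1 / 2 :> R by lra.
(* Admissibility places [Q] under the gluing clause of the standing conditions; the nuisances of the
   glued law are read off [Q]. *)
have gQ : forall m, glues M P (localized M P m Q) (fun=> True).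
  case: standM => _ _ _ /(_ _ MP)[_ _ /(_ Q)] + _.
  by move=> /(_ (measurable_univ_measurable mQ) admQ)[].
have glQ : {ae PX, forall x,
    (Q x).-integrable setT (fun o => (at_law M f P w x o)%:E) /\
    (\int[Q x]_o (at_law M f P w x o)%:E = (psi M x (uval M P x))%:E)%E}.
  (* The target value of [uval] is the baseline one, so both alternatives coincide and [kappa], a
     function of [uval], is unchanged. *)
  apply: (glued_identity structM standM fFB mw MP gQ) => [|P' MP' _]; last first.
    by apply: filterS => x; rewrite /kappa => -[] ->.
  apply: aeW => x; rewrite /Q; case: asboolP => Bx.
    exists (Ls x); first exact: dQ0.
    move=> b; rewrite /Ls; case: eqP => [->|_]; first exact: (Lh _ Bx).2.
    exact: (hL x b).2.
  by exists (fun b => arm_law M P b x); [exact: dP|move=> b; exact: (hL x b).2].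
move: glQ ae_arm_mean_sum ae_arm_integrable.
apply: filterS3 => x [_ +] + iF Bx; rewrite /Q asboolT// -(qB _ Bx) => QE CE.
have mx := measurable_at_law_section fFB mw MP x.
have mFx b : measurable_fun [set: borel Wt] (F b x).
  by apply/measurable_EFinP; exact: measurable_int (iF b).
have [iFnu FnuE] := nuE x _ (mFx a).
move: QE; rewrite (integral_arm (p0 x) (dQ0 x) mx) => [|b]; last first.
  rewrite /Ls; case: eqP => [->|_]; last exact: (iF b).
  exact: (integrable_convex_pair half01 (iF a) iFnu).
(* The other arms contribute equally to both sides. Cancelling them and the propensity of [a] leaves
   the half-half average of [arm_mean] and the two-point mean equal to [arm_mean]. *)
rewrite -CE (bigD1 a)//= [in RHS](bigD1 a)//= /Ls eqxx.
have -> := integral_convex_pair half01 (iF a) iFnu.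
rewrite -/(F a x) arm_meanE// FnuE.
under eq_bigr => b ba do rewrite (negbTE ba) -/(F b x) arm_meanE// -EFinM.
rewrite sumEFin -[X in (_ * (X + _))%E]EFinM -[X in (_ * (_ + X))%E]EFinM.
rewrite -[X in (_ * X)%E]EFinD -EFinM -EFinD => -[] /addIr /mulfI.
rewrite gt_eqF// => /(_ isT) h; lra.
Qed.

Section arm.
Variable a : A.

(** [k] and [H] are coordinates centred at the mean point, in which the claim becomes
    proportionality of [H] to [k]. *)
Let k (x : X) (t : Wt) : R := score M a t - uval M P x a.

Let H (x : X) (t : Wt) : R := F a x t - arm_mean a x.

Let measurable_graph (y : borel X -> borel Wt) : measurable_fun [set: borel X] y ->
  measurable_fun [set: borel X] (fun x => (x, y x)).
Proof. by move=> my; exact: measurable_fun_pair. Qed.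

Let mk : measurable_fun [set: borel X * borel Wt]
  (fun z : borel X * borel Wt => k z.1 z.2).
Proof.
apply: measurable_funB; first exact: (measurableT_comp (mh a) measurable_snd).
have mu : measurable_fun [set: borel X] (fun x : borel X => uval M P x a).
  case: structM => _ _ /(_ _ MP)[mu _ _ _] _ _; exact: measurable_coordinate mu.
exact: (measurableT_comp mu measurable_fst).
Qed.

Let mH : measurable_fun [set: borel X * borel Wt]
  (fun z : borel X * borel Wt => H z.1 z.2).
Proof.
apply: measurable_funB; first exact: measurable_arm_at_law.
exact: (measurableT_comp (measurable_arm_mean a) measurable_fst).
Qed.

Let at_graph (g : borel X * borel Wt -> R) (y : borel X -> borel Wt) :
  measurable_fun [set: borel X * borel Wt] g -> measurable_fun [set: borel X] y ->
  measurable_fun [set: borel X] (fun x => g (x, y x)).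
Proof. by move=> mg /measurable_graph my; exact: (measurableT_comp mg my). Qed.

(** Equality of the slopes [H / k] at two points on opposite sides of the mean, in cross-multiplied
    form. *)
Lemma two_point_slope (B : set (borel X)) (y1 y2 : borel X -> borel Wt) :
  measurable B -> measurable_fun [set: borel X] y1 ->
  measurable_fun [set: borel X] y2 ->
  (forall x, B x -> [/\ supp (arm_law M P a x) (y1 x),
    supp (arm_law M P a x) (y2 x), 0 < k x (y1 x) & k x (y2 x) < 0]) ->
  {ae PX, forall x, B x -> H x (y1 x) * k x (y2 x) = H x (y2 x) * k x (y1 x)}.
Proof.
move=> mB my1 my2 HB.
(* The weight solving [p * k1 + (1 - p) * k2 = 0]; it lies in the unit interval because [k1] and
   [k2] have opposite signs. *)
pose p x := - k x (y2 x) / (k x (y1 x) - k x (y2 x)).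
have mp : measurable_fun [set: borel X] (p : borel X -> R).
  apply: measurable_funM.
    by apply: measurableT_comp => //; exact: (at_graph mk my2).
  apply: (measurableT_comp (@measurable_inverse R)); apply: measurable_funB.
    exact: (at_graph mk my1).
  exact: (at_graph mk my2).
have pE x : B x -> [/\ 0 < k x (y1 x), k x (y2 x) < 0
    & p x * (k x (y1 x) - k x (y2 x)) = - k x (y2 x)].
  move=> /HB[_ _ k1 k2]; split=> //; rewrite /p mulfVK//.
  by rewrite gt_eqF// subr_gt0 (lt_trans k2).
have := @two_point_identity a B y1 y2 p mB my1 my2 mp.
case=> [x Bx|N [mN N0 NE]].
  have [s1 s2 _ _] := HB _ Bx; have [k1 k2 pk] := pE _ Bx; split=> //.
    rewrite /p ler_pdivlMr ?ler_pdivrMr ?mul0r ?mul1r; lra.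
  move: pk; rewrite /k; lra.
exists N; split=> //; apply: subset_trans NE; apply: subsetC => x /= + Bx.
move=> /(_ Bx) E; have [_ _ pk] := pE _ Bx.
rewrite /H -E; move: pk; set k1 := k x (y1 x); set k2 := k x (y2 x) => pk.
have [e1 e2] : k1 = (1 - p x) * (k1 - k2) /\ k2 = - (p x * (k1 - k2)).
  by split; rewrite ?mulrBl pk ?mul1r opprK ?subrK.
move: e1 e2; set e := k1 - k2 => -> ->; ring.
Qed.

(** One selected point [yp] with positive centred score fixes the slope. Points off the resulting
    line are excluded separately for [k] zero, negative and positive, each time by a selection among
    them. *)
Lemma arm_affine : exists beta c : X -> R,
  [/\ measurable_fun [set: borel X] (beta : borel X -> R),
      measurable_fun [set: borel X] (c : borel X -> R)
    & {ae PX, forall x,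
        {ae arm_law M P a x, forall t, F a x t = beta x * score M a t + c x} /\
        beta x * uval M P x a + c x = arm_mean a x}].
Proof.
have select G := large_section_selection polWt (measurable_arm_law a) PX (G := G).
have mset (g : borel X * borel Wt -> R) : measurable_fun setT g ->
    measurable [set z | 0 < g z].
  by move=> mg; rewrite -[X in measurable X]setTI; exact: measurable_fun_ltr.
have mset' (g : borel X * borel Wt -> R) : measurable_fun setT g ->
    measurable [set z | g z < 0].
  by move=> mg; rewrite -[X in measurable X]setTI; exact: measurable_fun_ltr.
have [Bp [yp [mBp myp HBp aeBp]]] := select _ (mset _ mk).
have [Bm [ym [mBm mym HBm aeBm]]] := select _ (mset' _ mk).
(* For almost every [x] outside [Bp] the score is almost surely constant, and the slope [0] is
   adequate. *)
pose beta (x : borel X) : R :=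
  if `[< Bp x >] then H x (yp x) / k x (yp x) else 0.
have mbeta : measurable_fun [set: borel X] beta.
  apply: measurable_fun_ifT => //.
    apply: (measurable_fun_bool true).
    by rewrite setTI (_ : _ @^-1` _ = Bp)//; apply/seteqP; split=> x /= /asboolP.
  apply: measurable_funM; first exact: (at_graph mH myp).
  exact: (measurableT_comp (@measurable_inverse R) (at_graph mk myp)).
pose c (x : borel X) : R := arm_mean a x - beta x * uval M P x a.
have mc : measurable_fun [set: borel X] c.
  apply: measurable_funB; first exact: measurable_arm_mean.
  apply: measurable_funM => //.
  case: structM => _ _ /(_ _ MP)[mu _ _ _] _ _; exact: measurable_coordinate mu.
pose bad (z : borel X * borel Wt) := H z.1 z.2 != beta z.1 * k z.1 z.2.
have mbad : measurable [set z | bad z].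
  have -> : [set z | bad z] =
      (fun z => H z.1 z.2 == beta z.1 * k z.1 z.2) @^-1` [set false].
    by apply/seteqP; split=> z /=; rewrite /bad; case: eqP.
  rewrite -[X in measurable X]setTI; apply: measurable_fun_eqr => //.
  exact: (measurable_funM (measurableT_comp mbeta measurable_fst) mk).
have mk0 : measurable [set z : borel X * borel Wt | k z.1 z.2 = 0].
  have -> : [set z : borel X * borel Wt | k z.1 z.2 = 0] =
      (fun z => k z.1 z.2 == 0) @^-1` [set true].
    by apply/seteqP; split=> z /= /eqP.
  by rewrite -[X in measurable X]setTI; apply: measurable_fun_eqr.
have [B0 [y0 [mB0 my0 HB0 aeB0]]] := select _ (measurableI _ _ mk0 mbad).
have [Bp' [yp' [mBp' myp' HBp' aeBp']]] :=
  select _ (measurableI _ _ (mset _ mk) mbad).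
have [Bm' [ym' [mBm' mym' HBm' aeBm']]] :=
  select _ (measurableI _ _ (mset' _ mk) mbad).
(* Where [k] vanishes a single atom already has the right score mean, so the two-point identity with
   weight [1] gives [H = 0]. *)
have nB0 : {ae PX, forall x, ~ B0 x}.
  have HB x : B0 x -> [/\ 0 <= (1 : R) <= 1, supp (arm_law M P a x) (y0 x),
      supp (arm_law M P a x) (y0 x)
      & 1 * score M a (y0 x) + (1 - 1) * score M a (y0 x) = uval M P x a].
    move=> /HB0[[/= k0 _] s0]; split=> //; first by rewrite ler01 lexx.
    by rewrite subrr mul0r addr0 mul1r; apply/eqP; rewrite -subr_eq0; exact/eqP.
  have := two_point_identity (p := fun=> 1) mB0 my0 my0 (measurable_cst _) HB.
  apply: filterS => x HF Bx; have [[/= k0 /negP bx] _] := HB0 _ Bx; apply: bx.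
  have := HF Bx; rewrite mul1r subrr mul0r addr0 => FE.
  by rewrite k0 mulr0 /H FE subrr.
(* A negative point is compared directly with [yp], which lies on the other side of the mean. *)
have nBm' : {ae PX, forall x, Bp x -> ~ Bm' x}.
  have HB x : (Bp `&` Bm') x -> [/\ supp (arm_law M P a x) (yp x),
      supp (arm_law M P a x) (ym' x), 0 < k x (yp x) & k x (ym' x) < 0].
    by move=> [/HBp[kp sp] /HBm'[[km _] sm]].
  have := two_point_slope (measurableI _ _ mBp mBm') myp mym' HB.
  apply: filterS => x HF Bpx Bmx; have [[/= km /negP bx] _] := HBm' _ Bmx.
  apply: bx; have [/= kp _] := HBp _ Bpx; apply/eqP.
  rewrite /beta asboolT// mulrAC (HF (conj Bpx Bmx)) mulfK//.
  by rewrite gt_eqF.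
(* Two positive points cannot be compared directly; both [yp'] and [yp] are compared with the
   negative point [ym]. *)
have nBp' : {ae PX, forall x, Bp x -> Bm x -> ~ Bp' x}.
  have HB x : (Bp `&` Bm) x -> [/\ supp (arm_law M P a x) (yp x),
      supp (arm_law M P a x) (ym x), 0 < k x (yp x) & k x (ym x) < 0].
    by move=> [/HBp[kp sp] /HBm[km sm]].
  have HB' x : (Bp' `&` Bm) x -> [/\ supp (arm_law M P a x) (yp' x),
      supp (arm_law M P a x) (ym x), 0 < k x (yp' x) & k x (ym x) < 0].
    by move=> [/HBp'[[kp _] sp] /HBm[km sm]].
  have := two_point_slope (measurableI _ _ mBp mBm) myp mym HB.
  have := two_point_slope (measurableI _ _ mBp' mBm) myp' mym HB'.
  apply: filterS2 => x HF' HF Bpx Bmx Bpx'.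
  have [[/= kp' /negP bx] _] := HBp' _ Bpx'; apply: bx.
  have [/= kp _] := HBp _ Bpx; have [/= km _] := HBm _ Bmx; apply/eqP.
  rewrite /beta asboolT// mulrAC.
  apply: (mulIf (x := k x (yp x))); first by rewrite gt_eqF.
  rewrite mulfVK ?gt_eqF//.
  apply: (mulIf (x := k x (ym x))); first by rewrite lt_eqF.
  rewrite mulrAC (HF' (conj Bpx' Bmx)) [RHS]mulrAC (HF (conj Bpx Bmx)).
  by rewrite mulrAC.
exists beta, c; split=> //.
have nbad : {ae PX, forall x, [/\ ~ B0 x, Bp x -> ~ Bm' x
    & Bp x -> Bm x -> ~ Bp' x]}.
  by move: nB0 nBm' nBp'; apply: filterS3.
pose pos (G : set (borel X * borel Wt)) (x : X) : bool :=
  (0 < arm_law M P a x (xsection G x))%E.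
have sel1 : {ae PX, forall x,
    (pos [set z | 0 < k z.1 z.2] x -> Bp x) /\
    (pos [set z | k z.1 z.2 < 0] x -> Bm x)}.
  by move: aeBp aeBm; apply: filterS2.
have sel2 : {ae PX, forall x, [/\
    pos ([set z | k z.1 z.2 = 0] `&` [set z | bad z]) x -> B0 x,
    pos ([set z | 0 < k z.1 z.2] `&` [set z | bad z]) x -> Bp' x
  & pos ([set z | k z.1 z.2 < 0] `&` [set z | bad z]) x -> Bm' x]}.
  by move: aeB0 aeBp' aeBm'; apply: filterS3.
have nbad' : {ae PX, forall x, ~ pos [set z | bad z] x}.
  move: nbad sel1 sel2.
  apply: filterS3 => x [n0 nm np] [sp sm] [s0 sp' sm'].
  have [ih hE] := hL x a.
  have mkx : measurable_fun [set: borel Wt] (k x).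
    by apply: measurable_funB => //; exact: mh.
  have ik : (arm_law M P a x).-integrable [set: borel Wt] (EFin \o k x).
    have := integrableB measurableT ih
      (finite_measure_integrable_cst _ (uval M P x a) measurableT).
    by apply: eq_integrable => // t _; rewrite /= EFinB.
  have k0 : (\int[arm_law M P a x]_t (k x t)%:E = 0)%E.
    rewrite -(subee (x := (uval M P x a)%:E))// -{1}hE unlock.
    have <- : (\int[arm_law M P a x]_t cst (uval M P x a)%:E t =
        (uval M P x a)%:E)%E.
      rewrite integral_cst//.
      by rewrite [X in (_ * X)%E](probability_setT (arm_law M P a x)) mule1.
    rewrite -(integralB measurableT ih
      (finite_measure_integrable_cst _ _ measurableT)).
    by apply: eq_integral => t _; rewrite /= EFinB.
  (* The centred score has mean zero, so positive and negative values have positive measure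
     together; this supplies the points on both sides required above. *)
  have kpos : pos [set z | k z.1 z.2 < 0] x -> pos [set z | 0 < k z.1 z.2] x.
    rewrite /pos !xsectionE; exact: (zero_mean_gt0 ik k0).
  have kneg : pos [set z | 0 < k z.1 z.2] x -> pos [set z | k z.1 z.2 < 0] x.
    rewrite /pos !xsectionE => kp.
    have := @zero_mean_gt0 _ _ _ (arm_law M P a x) (fun t => - k x t).
    rewrite (_ : [set t | 0 < - k x t] = [set t | k x t < 0]); last first.
      by apply/seteqP; split=> t /=; rewrite oppr_gt0.
    apply.
    - have := integrableN ik.
      by apply: eq_integrable => // t _; rewrite /= EFinN.
    - rewrite (_ : (\int[_]_t _ = \int[arm_law M P a x]_t - (k x t)%:E)%E)//.
      by rewrite (integralN (integrable_add_def measurableT ik)) k0 oppe0.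
    - rewrite (_ : [set t | - k x t < 0] = [set t | 0 < k x t])//.
      by apply/seteqP; split=> t /=; rewrite oppr_lt0.
  have mono G G' : measurable G -> measurable G' -> G `<=` G' ->
      pos G x -> pos G' x.
    move=> mG mG' GG'; rewrite /pos => /lt_le_trans; apply.
    by apply: le_measure; rewrite ?inE; [exact: measurable_xsection..|
      exact: le_xsection].
  have npos G : measurable G -> ~ pos G x ->
      arm_law M P a x (xsection G x) = 0%E.
    move=> mG /negP; rewrite /pos -leNgt => Gle.
    by apply/eqP; rewrite eq_le Gle measure_ge0.
  have mGp := measurableI _ _ (mset _ mk) mbad.
  have mGm := measurableI _ _ (mset' _ mk) mbad.
  have mG0 := measurableI _ _ mk0 mbad.
  have e0 := npos _ mG0 (fun h => n0 (s0 h)).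
  have ep : arm_law M P a x (xsection
      ([set z | 0 < k z.1 z.2] `&` [set z | bad z]) x) = 0%E.
    apply: npos => // h; have hp := mono _ _ mGp (mset _ mk) (@subIsetl _ _ _) h.
    by apply: (np (sp hp) (sm (kneg hp))); exact: sp'.
  have em : arm_law M P a x (xsection
      ([set z | k z.1 z.2 < 0] `&` [set z | bad z]) x) = 0%E.
    apply: npos => // h; have hm := mono _ _ mGm (mset' _ mk) (@subIsetl _ _ _) h.
    by apply: (nm (sp (kpos hm))); exact: sm'.
  rewrite /pos; apply/negP; rewrite -leNgt.
  have mx G (mG : measurable G) : measurable (xsection G x : set (borel Wt)).
    exact: measurable_xsection.
  apply: (@le_trans _ _ (arm_law M P a x (
      xsection ([set z | k z.1 z.2 = 0] `&` [set z | bad z]) x `|`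
      (xsection ([set z | 0 < k z.1 z.2] `&` [set z | bad z]) x `|`
       xsection ([set z | k z.1 z.2 < 0] `&` [set z | bad z]) x)))).
    apply: le_measure; rewrite ?inE; first exact: mx.
      by apply: measurableU; [exact: mx|apply: measurableU; exact: mx].
    move=> t; rewrite !xsectionE /= => bt.
    by have [kt|kt|kt] := ltgtP (k x t) 0; [right; right|right; left|left].
  rewrite -[leRHS](adde0 0%E) -{1}e0 -[in leRHS](adde0 0%E) -{1}ep -{1}em.
  apply: le_trans (leeD (lexx _) _); last first.
    by apply: measureU2; exact: mx.
  by apply: measureU2; [exact: mx|apply: measurableU; exact: mx].
apply: filterS nbad' => x /negP; rewrite /pos -leNgt => badx; split.
  exists (xsection [set z | bad z] x); split.
  - exact: measurable_xsection.
  - by apply/eqP; rewrite -measure_le0.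
  - move=> t /= nE; rewrite xsectionE /= /bad /=; apply/eqP => HE; apply: nE.
    move: HE; rewrite /H /k /c => HE; lra.
by rewrite /c addrC subrK.
Qed.

End arm.

End contamination.

(** * Shifted arm means *)

Lemma ae_forall_fin d (T : measurableType d) (R : realType)
    (m : {measure set T -> \bar R}) (I : finType) (Q : I -> T -> Prop) :
  (forall i, {ae m, forall x, Q i x}) -> {ae m, forall x, forall i, Q i x}.
Proof.
move=> aeQ; have : {ae m, forall x, forall n i, enum_rank i = n :> nat -> Q i x}.
  apply: ae_foralln => n.
  have [[i ri]|ni] := pselect (exists i : I, enum_rank i = n :> nat).
    apply: filterS (aeQ i) => x Qx j.
    by rewrite -ri => /ord_inj/enum_rank_inj ->.
  by apply: aeW => x i ri; case: ni; exists i.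
by apply: filterS => x Qx i; exact: (Qx (enum_rank i)).
Qed.

(** * The maximum over the arms under small shifts *)

Section max_arm.
Context (R : realType) (A : pfinType) (X : ptopologicalType).
Variables (g : X -> A -> R -> R) (x : X).
Implicit Types v : A -> R.

Lemma max_armP v b : b \in active g x v -> max_arm g x v = g x b (v b).
Proof.
rewrite inE => /forallP bmax; apply/eqP; rewrite eq_le; apply/andP; split.
  by apply/bigmax_leP; split.
exact: le_bigmax.
Qed.

Lemma active_nonempty v : exists b, b \in active g x v.
Proof.
have [b _ bmax] := @arg_maxP _ _ A point xpredT (fun a => g x a (v a)) isT.
by exists b; rewrite inE; apply/forallP => c; exact: bmax.
Qed.

(** Both maxima are attained at arms other than [a], where the two vectors agree. *)
Lemma max_arm_inactive v v' a : (forall b, b != a -> v' b = v b) ->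
  a \notin active g x v -> a \notin active g x v' ->
  max_arm g x v' = max_arm g x v.
Proof.
move=> vv' av av'.
have [b bv] := active_nonempty v; have [b' bv'] := active_nonempty v'.
have ba : b != a by apply: contraNneq av => <-.
have ba' : b' != a by apply: contraNneq av' => <-.
rewrite (max_armP bv) (max_armP bv') (vv' _ ba').
apply/eqP; rewrite eq_le; apply/andP; split.
  by move: bv; rewrite inE => /forallP.
by move: bv'; rewrite inE => /forallP/(_ b); rewrite !vv'.
Qed.

(** The active values rise together by [t]; as [t] is nonnegative, the unmoved inactive values stay
    below. *)
Lemma max_arm_tie v (r : A -> R) t : 0 <= t ->
  (forall a, a \notin active g x v -> r a = 0) ->
  (forall a, a \in active g x v -> g x a (v a + r a) = g x a (v a) + t) ->
  max_arm g x (fun a => v a + r a) = max_arm g x v + t.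
Proof.
move=> t0 r0 rt; have [b bv] := active_nonempty v.
rewrite (max_armP bv) -(rt _ bv); apply: max_armP.
rewrite inE; apply/forallP => c; rewrite (rt _ bv).
have bmax : g x c (v c) <= g x b (v b) by move: bv; rewrite inE => /forallP.
have [cv|cv] := boolP (c \in active g x v); first by rewrite rt// lerD2r.
by rewrite r0// addr0 (le_trans bmax)// lerDl.
Qed.

End max_arm.

(** If [phi] has slope [s] on the range of the path, then [s * r t = t]. So [s] is nonzero, the path
    is linear, and its range is a neighbourhood of [u], which identifies [s] with the derivative. *)
Lemma affine_path_deriv (R : realType) (phi r : R -> R) (u e : R) : 0 < e ->
  r 0 = 0 -> (forall t, `|t| < e -> phi (u + r t) = phi u + t) ->
  affine_on [set u + r t | t in [set t : R | `|t| < e]] phi ->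
  derive1 phi u != 0 /\ forall t, `|t| < e -> r t = t / derive1 phi u.
Proof.
move=> e0 r0 pt [s [b sb]].
have path t : `|t| < e -> s * r t = t.
  move=> te; have h0 : `|0 : R| < e by rewrite normr0.
  have E : phi (u + r t) = s * (u + r t) + b by apply: sb; exists t.
  have E0 : phi (u + r 0) = s * (u + r 0) + b by apply: sb; exists 0.
  move: E E0; rewrite pt// r0 addr0 => E E0; move: E; rewrite E0 => E; lra.
have s0 : s != 0.
  apply/eqP => s0; have := path (e / 2).
  rewrite s0 mul0r ger0_norm; last by lra.
  by move=> h; have := h ltac:(lra); lra.
(* The path reaches each [v] near [u] at time [s * (v - u)]. *)
have near_affine : \forall v \near u, phi v = s * v + b.
  near=> v; have vE : v = u + r (s * (v - u)).
    have : s * r (s * (v - u)) = s * (v - u).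
      apply: path; rewrite normrM mulrC -ltr_pdivlMr ?normr_gt0// distrC.
      near: v; apply: (nbhsx_ballx u (e / `|s|)).
      by rewrite divr_gt0// normr_gt0.
    by move=> /(mulfI s0) ->; rewrite addrC subrK.
  rewrite {1}vE sb -?vE//; exists (s * (v - u)) => //=.
  rewrite normrM mulrC -ltr_pdivlMr ?normr_gt0// distrC.
  near: v; apply: (nbhsx_ballx u (e / `|s|)).
  by rewrite divr_gt0// normr_gt0.
have -> : derive1 phi u = s.
  rewrite derive1E; have -> : 'D_1 phi u = 'D_1 (fun v => s * v + b) u.
    by apply: near_eq_derive; rewrite ?oner_eq0.
  have -> : (fun v => s * v + b) = (s \*: id) \+ cst b by [].
  rewrite deriveD ?deriveZ ?derive_id ?derive_cst ?addr0 ?scaler1//.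
split=> // t te; rewrite -{2}(path _ te) mulrC mulKf//.
Unshelve. all: end_near. Qed.

(** * Constraints on the slopes from shifted means *)

Section shift.
Context (R : realType) (A : pfinType) (X Wt Waux : ptopologicalType).
Variables (M : max_arm_model R A X Wt) (D : perturbation_data R A X Wt).
Hypotheses (structM : max_arm_structure M) (standM : standing_conditions M)
  (pertM : perturbation_conditions M D).
Variable f : borel X * obs A Wt * (vec R A * vec R A) * discrete {set A}
         * borel Waux -> R.
Hypothesis fFB : F_B M f.
Variable w : X -> Waux.
Hypothesis mw : measurable_fun [set: borel X] (w : borel X -> borel Waux).
Variable P : law R A X Wt.
Hypothesis MP : laws M P.
Local Notation obs := (obs A Wt).

Let F (a : A) (x : X) (t : Wt) : R := at_law M f P w x (a, t).

Let PX : probability (borel X) R := marginal P.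

Variables beta c : A -> X -> R.
Hypothesis affineF : {ae PX, forall x, forall a, {ae arm_law M P a x, forall t,
  F a x t = beta a x * score M a t + c a x}}.
Hypothesis affine_sum : {ae PX, forall x, \sum_a propensity M P x a *
  (beta a x * uval M P x a + c a x) = psi M x (uval M P x)}.

(** Under the shifted law, affine [F] integrates to its value at the shifted score means;
    subtracting the baseline identity cancels the intercepts. *)
Lemma shift_identity (delta : X -> A -> R) :
  measurable_fun [set: borel X] (delta : borel X -> vec R A) ->
  {ae PX, forall x, dirs D P x (delta x)} ->
  {ae PX, forall x, \sum_a propensity M P x a * (beta a x * delta x a) =
     psi M x (fun a => uval M P x a + delta x a) - psi M x (uval M P x)}.
Proof.
move=> mdelta Ddelta.
have [_ _ [shiftx _ shiftg]] := pertM MP.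
have [_ gQ] := shiftg _ (measurable_univ_measurable (R := R) mdelta) Ddelta.
have := glued_identity structM standM fFB mw MP
  (v := fun x a => uval M P x a + delta x a) gQ.
have decQ : {ae PX, forall x, exists2 L,
    arm_decomposition (shifted D P x (delta x)) (propensity M P x) L &
    forall a, ('E_(L a)[score M a] = (uval M P x a + delta x a)%:E)%E}.
  move: shiftx Ddelta; apply: filterS2 => x [_ /(_ (delta x)) H] /H[_ [L dL hL] _ _ _].
  by exists L => // a; case: (hL a).
move=> /(_ decQ) glued.
have {glued} : {ae PX, forall x,
    (shifted D P x (delta x)).-integrable setT
      (fun o => (at_law M f P w x o)%:E) /\
    (\int[shifted D P x (delta x)]_o (at_law M f P w x o)%:E =
      (psi M x (fun a => uval M P x a + delta x a))%:E)%E}.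
  by apply: glued => P' MP' EP' _; apply: filterS EP' => x [].
have ident : {ae PX, forall x, (forall a, {ae arm_law M P a x, forall t,
      F a x t = beta a x * score M a t + c a x}) /\
    \sum_a propensity M P x a * (beta a x * uval M P x a + c a x) =
      psi M x (uval M P x)}.
  by move: affineF affine_sum; apply: filterS2.
have shifted_dec : {ae PX, forall x, shifted D P x (delta x) `<< cond M P x /\
    exists2 L, arm_decomposition (shifted D P x (delta x)) (propensity M P x) L &
    forall a, (L a).-integrable [set: borel Wt] (EFin \o score M a) /\
      ('E_(L a)[score M a] = (uval M P x a + delta x a)%:E)%E}.
  by move: shiftx Ddelta; apply: filterS2 => x [_ /(_ (delta x)) H] /H[].
move: ident shifted_dec.
apply: filterS3 => x [aff sumE] [dom [L dL hL]] [iQ QE].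
have p0 a : 0 < propensity M P x a.
  by case: structM => _ /(_ _ MP)[_ _ _ _ /(_ x a)].
have dP : arm_decomposition (cond M P x) (propensity M P x)
    (fun a => arm_law M P a x).
  by case: structM => _ /(_ _ MP)[_ _ _ /(_ x)].
have mx := measurable_at_law_section fFB mw MP x.
have iF a : (L a).-integrable [set: borel Wt] (EFin \o F a x).
  exact: (arm_integrable p0 dL mx a iQ).
(* The affine form is known only almost surely under the baseline arm law. Domination of the joint
   conditional law passes to each arm because its propensity is positive. *)
have Ldom a (N : set (borel Wt)) : measurable N ->
    arm_law M P a x N = 0%E -> L a N = 0%E.
  move=> mN N0; have mN' : measurable ([set (a : discrete A)] `*` N).
    exact: measurableX (discrete_measurable _) mN.
  have : shifted D P x (delta x) ([set (a : discrete A)] `*` N) = 0%E.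
    have /null_content_dominatesP := dom; apply => //.
    by have := dP a N mN; rewrite N0 mule0.
  rewrite dL// => /eqP; rewrite mule_eq0 => /orP[|/eqP//].
  by rewrite eqe gt_eqF.
have FE a : (\int[L a]_t (F a x t)%:E =
    (beta a x * (uval M P x a + delta x a) + c a x)%:E)%E.
  have [ih hE] := hL a.
  have ib : (L a).-integrable [set: borel Wt]
      (fun t => (beta a x)%:E * (score M a t)%:E)%E by exact: integrableZl.
  have ic : (L a).-integrable [set: borel Wt] (fun=> (c a x)%:E).
    exact: finite_measure_integrable_cst.
  transitivity (\int[L a]_t ((beta a x)%:E * (score M a t)%:E + (c a x)%:E))%E.
    apply: ae_eq_integral => //; first exact: measurable_int (iF a).
      by apply: emeasurable_funD; [exact: measurable_int ib|exact: measurable_int ic].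
    have : {ae L a, forall t, F a x t = beta a x * score M a t + c a x}.
      by apply: ae_dominated (aff a) => N mN N0; exact: Ldom.
    by apply: filterS => t tE _; rewrite tE EFinD EFinM.
  rewrite integralD// integralZl// integral_cst//.
  rewrite [X in ((c a x)%:E * X)%E](probability_setT (L a)) mule1.
  by move: hE; rewrite unlock => ->; rewrite -EFinM -EFinD.
have : \sum_a propensity M P x a *
    (beta a x * (uval M P x a + delta x a) + c a x) =
    psi M x (fun a => uval M P x a + delta x a).
  apply: EFin_inj; rewrite -QE (integral_arm p0 dL mx)// -sumEFin.
  by apply: eq_bigr => a _; rewrite EFinM -FE.
rewrite -sumE => <-; rewrite -sumrB; apply: eq_bigr => a _; ring.
Qed.

(** A small shift of a relaxed arm leaves the maximum unchanged, so the product of propensity, slope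
    and shift is zero. *)
Lemma relaxed_slope0 :
  {ae PX, forall x, forall a, a \in relaxed D P x -> beta a x = 0}.
Proof.
have [_ [mD D0 mrel nearD _] _] := pertM MP.
have cdlink x a : cont_diff_on (arm_range M) (link M x a).
  by case: structM => -[_ ? _].
have range x a : arm_range M (uval M P x a).
  by case: structM => _ _ /(_ _ MP)[_ ? _ _].
have p0 x a : 0 < propensity M P x a.
  by case: structM => _ /(_ _ MP)[_ _ _ _ /(_ x a)].
apply: ae_forall_fin => a.
(* How small the shift must be depends on [x]. Using the countably many sizes [1/(n+1)], with the
   null direction where a size is not permitted, avoids a measurable choice of size. *)
pose good n := [set x : borel X | a \in relaxed D P x /\
  dirs D P x (unit_dir a (harmonic n))].
pose delta n (x : borel X) : vec R A :=
  if `[< good n x >] then unit_dir a (harmonic n) else (fun=> 0).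
have mdelta n : measurable_fun [set: borel X] (delta n).
  apply: measurable_fun_ifT => //.
  apply: (measurable_fun_bool true); rewrite setTI.
  rewrite (_ : _ @^-1` _ = (relaxed D P @^-1` [set S : {set A} | a \in S]) `&`
      ((fun x : borel X => (x, unit_dir a (harmonic n) : vec R A)) @^-1`
       [set z | dirs D P z.1 z.2])); last first.
    by apply/seteqP; split=> x /= /asboolP.
  apply: measurableI; rewrite -[X in measurable X]setTI.
    by apply: mrel => //; exact: discrete_measurable.
  by apply: pair2_measurable.
have Ddelta n : {ae PX, forall x, dirs D P x (delta n x)}.
  by apply: filterS D0 => x D0x; rewrite /delta; case: asboolP => // -[].
have aeid : {ae PX, forall x, forall n,
    \sum_a propensity M P x a * (beta a x * delta n x a) =
     psi M x (fun a => uval M P x a + delta n x a) - psi M x (uval M P x)}.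
  by apply: ae_foralln => n; exact: shift_identity.
move: aeid nearD; apply: filterS2 => x idx nearDx arel.
have [aker nearDa] := nearDx _ arel.
(* The link of [a] is continuous and strictly below that of some other arm [b], which the shift does
   not move. *)
have near_inactive : \forall t \near (0 : R),
    a \notin active (link M) x (fun b => uval M P x b + unit_dir a t b).
  move: aker; rewrite /kappa inE negb_forall => /existsP[b]; rewrite -ltNge => ab.
  have ba : b != a by apply: contraTneq ab => ->; rewrite ltxx.
  have cont : {for uval M P x a, continuous (link M x a)}.
    apply: differentiable_continuous; apply/derivable1_diffP.
    by have [+ _] := cdlink x a; apply.
  have shift0 : (fun t : R => uval M P x a + t) @ (0 : R) --> uval M P x a.
    rewrite -[X in _ --> X]addr0; apply: cvgD; [exact: cvg_cst|exact: cvg_id].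
  have near_lt : \forall t \near (0 : R),
      link M x a (uval M P x a + t) < link M x b (uval M P x b).
    exact: (cvg_comp _ _ shift0 cont _ (lt_nbhsl ab)).
  apply: filterS near_lt => t tlt.
  rewrite inE negb_forall; apply/existsP; exists b.
  by rewrite -ltNge /unit_dir eqxx (negbTE ba) addr0.
have [n _ /(_ n (leqnn n)) [inact dirn]] : \forall n \near \oo,
    a \notin active (link M) x
      (fun b => uval M P x b + unit_dir a (harmonic n) b) /\
    dirs D P x (unit_dir a (harmonic n)).
  have : \forall t \near (0 : R),
    a \notin active (link M) x (fun b => uval M P x b + unit_dir a t b) /\
    dirs D P x (unit_dir a t).
    by move: near_inactive nearDa; apply: filterS2 => t ? H; split=> //; exact: H.
  exact: cvg_harmonic.
have := idx n; rewrite /delta asboolT//.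
rewrite [X in _ = X -> _](_ : _ = 0); last first.
  apply/eqP; rewrite subr_eq0; apply/eqP; apply: (max_arm_inactive (a := a)) => //.
  by move=> b ba; rewrite /unit_dir (negbTE ba) addr0.
rewrite (bigD1 a)//= big1 => [|b ba]; last by rewrite /unit_dir (negbTE ba) !mulr0.
rewrite addr0 /unit_dir eqxx => /eqP; rewrite !mulf_eq0.
rewrite (gt_eqF (p0 x a)) /= => /orP[/eqP//|].
by rewrite gt_eqF// harmonic_gt0.
Qed.

(** Along the tie-preserving path the maximum grows by the time [t], while each active mean moves by
    [t] over its link derivative; dividing by [t] gives the sum. *)
Lemma tie_slope_sum :
  {ae PX, forall x, forall a, a \in kappa M P x ->
     affine_on [set uval M P x a + tie_path D P x t a |
       t in [set t : R | `|t| < path_radius D P x]] (link M x a)} ->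
  {ae PX, forall x, \sum_(a in kappa M P x)
     propensity M P x a * beta a x / link_deriv M P a x = 1}.
Proof.
move=> affl; have [_ [_ _ _ _ [mrad rad0 mpath pathP]] _] := pertM MP.
(* A positive time inside the radius, measurable in [x]. *)
pose half (x : borel X) : R := path_radius D P x / 2.
have mhalf : measurable_fun [set: borel X] half by exact: measurable_funM.
have half_lt x : `|half x| < path_radius D P x.
  by rewrite /half ger0_norm; have := rad0 x => ?; lra.
pose delta (x : borel X) : vec R A := tie_path D P x (half x).
have mdelta : measurable_fun [set: borel X] delta.
  move=> _ B mB; rewrite setTI.
  (* [mpath] gives measurability only within the radius, a measurable region that contains the graph
     of [half]. *)
  have mgraph : measurable_fun [set: borel X] (fun x => (x, half x)).
    exact: measurable_fun_pair.
  have mrange : measurable [set z : borel X * R | `|z.2| < path_radius D P z.1].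
    rewrite -[X in measurable X]setTI; apply: measurable_fun_ltr => //.
      exact: (measurableT_comp (@normr_measurable R setT) measurable_snd).
    exact: (measurableT_comp mrad measurable_fst).
  have := mgraph measurableT _ (mpath mrange _ mB); rewrite setTI.
  congr measurable; apply/seteqP; split=> x /=; first by case.
  by split=> //; exact: half_lt.
have Ddelta : {ae PX, forall x, dirs D P x (delta x)}.
  by apply: filterS pathP => x [_ /(_ _ (half_lt x))[]].
have := shift_identity mdelta Ddelta.
move: affl pathP; apply: filterS3 => x affx [path0 pathx] sumE.
have [_ d0 dtie] := pathx _ (half_lt x).
have half0 : 0 < half x by rewrite divr_gt0.
move: sumE; rewrite [X in _ = X -> _](_ : _ = half x); last first.
  have := @max_arm_tie R A X (link M) x (uval M P x) (delta x) (half x)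
    (ltW half0) d0 dtie.
  by rewrite /psi => ->; rewrite addrAC subrr add0r.
rewrite (bigID (mem (kappa M P x)))/= [X in _ + X](_ : _ = 0) ?addr0; last first.
  by apply: big1 => a ak; rewrite /delta d0// !mulr0.
have derE a : a \in kappa M P x -> delta x a = half x / link_deriv M P a x.
  move=> ak; have linkE t : `|t| < path_radius D P x ->
      link M x a (uval M P x a + tie_path D P x t a) =
      link M x a (uval M P x a) + t.
    by move=> /pathx[_ _]; apply.
  have path0a : tie_path D P x 0 a = 0 by rewrite path0.
  have [_] := @affine_path_deriv R (link M x a)
    (fun t => tie_path D P x t a) _ _ (rad0 x) path0a linkE (affx a ak).
  by apply.
move=> sumE; apply: (mulfI (x := half x)); first by rewrite gt_eqF.
rewrite mulr1 -[RHS]sumE mulr_sumr; apply: eq_bigr => a ak.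
by rewrite derE//; ring.
Qed.

End shift.

(** * Collection of the arms and of the exceptional null sets *)

Theorem lemma5p5 (R : realType) (A : pfinType) (X Wt Waux : ptopologicalType)
    (polX : polish R X) (polWt : polish R Wt) (polWaux : polish R Waux)
    (M : max_arm_model R A X Wt) (D : perturbation_data R A X Wt)
    (structM : max_arm_structure M) (standM : standing_conditions M)
    (pertM : perturbation_conditions M D)
    (P : law R A X Wt) (MP : laws M P)
    (w : X -> Waux)
    (mw : measurable_fun [set: borel X] (w : borel X -> borel Waux))
    (f : borel X * obs A Wt * (vec R A * vec R A) * discrete {set A}
         * borel Waux -> R)
    (fFB : F_B M f)
    (regular : {ae marginal P, forall x,
      [/\ forall a, cont_diff_on (arm_range M) (link M x a) /\
            link_deriv M P a x != 0,
          forall a, a \in kappa M P x ->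
            affine_on [set uval M P x a + tie_path D P x t a |
                       t in [set t : R | `|t| < path_radius D P x]] (link M x a),
          forall a, 0 < propensity M P x a,
          forall a, ('V_(arm_law M P a x)[score M a] < +oo)%E
        & forall a, a \in kappa M P x ->
            (0 < 'V_(arm_law M P a x)[score M a])%E]}) :
  exists (beta c : A -> X -> R) (N : set (borel X)),
    [/\ forall a, measurable_fun [set: borel X] (beta a : borel X -> R),
        forall a, measurable_fun [set: borel X] (c a : borel X -> R),
        measurable N, marginal P N = 0%E
      & forall x, ~ N x ->
        [/\ forall a, {ae arm_law M P a x, forall wt,
              at_law M f P w x (a, wt) = beta a x * score M a wt + c a x},
            forall a0, kappa M P x = [set a0]%SET ->
              beta a0 x = link_deriv M P a0 x / propensity M P x a0 /\
              forall a, a \in relaxed D P x -> beta a x = 0,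
            (2 <= #|kappa M P x|)%N ->
              (forall a, a \in relaxed D P x -> beta a x = 0) /\
              \sum_(a in kappa M P x)
                propensity M P x a * beta a x / link_deriv M P a x = 1
          & \sum_a propensity M P x a * (beta a x * uval M P x a + c a x) =
            psibar M (x, (uval M P x, propensity M P x), kappa M P x)]].
Proof.
have affine a := arm_affine structM standM pertM fFB mw MP polWt a.
have /choice[bc bcP] (a : A) : exists bc : (X -> R) * (X -> R),
    [/\ measurable_fun [set: borel X] (bc.1 : borel X -> R),
      measurable_fun [set: borel X] (bc.2 : borel X -> R)
    & {ae marginal P, forall x,
        {ae arm_law M P a x, forall t, at_law M f P w x (a, t) =
          bc.1 x * score M a t + bc.2 x} /\
        bc.1 x * uval M P x a + bc.2 x = arm_mean M f w P a x}].
  by have [beta [c H]] := affine a; exists (beta, c).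
pose beta a := (bc a).1; pose c a := (bc a).2.
have aff : {ae marginal P, forall x, forall a,
    {ae arm_law M P a x, forall t,
      at_law M f P w x (a, t) = beta a x * score M a t + c a x} /\
    beta a x * uval M P x a + c a x = arm_mean M f w P a x}.
  by apply: ae_forall_fin => a; case: (bcP a).
have affF : {ae marginal P, forall x, forall a, {ae arm_law M P a x, forall t,
    at_law M f P w x (a, t) = beta a x * score M a t + c a x}}.
  by apply: filterS aff => x affx a; case: (affx a).
have affsum : {ae marginal P, forall x, \sum_a propensity M P x a *
    (beta a x * uval M P x a + c a x) = psi M x (uval M P x)}.
  move: aff (ae_arm_mean_sum structM standM fFB mw MP).
  apply: filterS2 => x affx <-; apply: eq_bigr => a _.
  by have [_ ->] := affx a.
have relaxed0 := relaxed_slope0 structM standM pertM fFB mw MP affF affsum.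
have affl : {ae marginal P, forall x, forall a, a \in kappa M P x ->
    affine_on [set uval M P x a + tie_path D P x t a |
       t in [set t : R | `|t| < path_radius D P x]] (link M x a)}.
  by apply: filterS regular => x [].
have tie := tie_slope_sum structM standM pertM fFB mw MP affF affsum affl.
have psibarE : {ae marginal P, forall x, psi M x (uval M P x) =
    psibar M (x, (uval M P x, propensity M P x), kappa M P x)}.
  by case: structM => _ _ _ _ [_ /(_ _ MP)].
have derN0 : {ae marginal P, forall x, forall a, link_deriv M P a x != 0}.
  by apply: filterS regular => x [H _ _ _ _] a; case: (H a).
have p0 x a : 0 < propensity M P x a.
  by case: structM => _ /(_ _ MP)[_ _ _ _ /(_ x a)].
have : {ae marginal P, forall x, [/\ forall a, {ae arm_law M P a x, forall wt,
      at_law M f P w x (a, wt) = beta a x * score M a wt + c a x},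
    forall a, a \in relaxed D P x -> beta a x = 0,
    \sum_(a in kappa M P x)
      propensity M P x a * beta a x / link_deriv M P a x = 1,
    \sum_a propensity M P x a * (beta a x * uval M P x a + c a x) =
      psibar M (x, (uval M P x, propensity M P x), kappa M P x)
    & forall a, link_deriv M P a x != 0]}.
  have sumE : {ae marginal P, forall x, \sum_a propensity M P x a *
      (beta a x * uval M P x a + c a x) =
      psibar M (x, (uval M P x, propensity M P x), kappa M P x)}.
    by move: affsum psibarE; apply: filterS2 => x ->.
  have rt : {ae marginal P, forall x,
      (forall a, a \in relaxed D P x -> beta a x = 0) /\
      \sum_(a in kappa M P x)
        propensity M P x a * beta a x / link_deriv M P a x = 1}.
    by move: relaxed0 tie; apply: filterS2.
  have da : {ae marginal P, forall x,
      (forall a, {ae arm_law M P a x, forall wt,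
        at_law M f P w x (a, wt) = beta a x * score M a wt + c a x}) /\
      forall a, link_deriv M P a x != 0}.
    by move: affF derN0; apply: filterS2.
  by move: sumE rt da; apply: filterS3 => x ? [? ?] [? ?].
move=> [N [mN N0 NE]]; exists beta, c, N; split => //.
- by move=> a; case: (bcP a).
- by move=> a; case: (bcP a).
- move=> x Nx; have [affx relx tiex sumx derx] :
    [/\ forall a, {ae arm_law M P a x, forall wt,
      at_law M f P w x (a, wt) = beta a x * score M a wt + c a x},
    forall a, a \in relaxed D P x -> beta a x = 0,
    \sum_(a in kappa M P x)
      propensity M P x a * beta a x / link_deriv M P a x = 1,
    \sum_a propensity M P x a * (beta a x * uval M P x a + c a x) =
      psibar M (x, (uval M P x, propensity M P x), kappa M P x)
    & forall a, link_deriv M P a x != 0].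
    by apply: contrapT => nx; apply: Nx; exact: NE.
  (* With one active arm the tie identity has a single term and is solved for the slope. *)
  split=> // a0 ka0; split=> //; move: tiex; rewrite ka0 big_set1 => tiex.
  apply: (mulfI (x := propensity M P x a0)); first by rewrite gt_eqF.
  rewrite mulrCA divff ?gt_eqF// mulr1.
  by apply: (divIf (derx a0)); rewrite tiex divff.
Qed.
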